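(* Let $\mathcal H,\mathcal K$ be complex Hilbert spaces and $A\in\mathcal B(\mathcal H,\mathcal K)$. Let $\overline{\mathcal O}_U^U(A)$ be the norm closure in $\mathcal B(\mathcal H,\mathcal K)$ of $\{VAU^{-1}: U\in\mathcal U(\mathcal H),\ V\in\mathcal U(\mathcal K)\}$. (a) If $\iota_i(A)\le\iota_f(A)$, then $$\overline{\mathcal O}_U^U(A)=\{B\in\mathcal B(\mathcal H,\mathcal K): B^*B\in\overline{\mathcal O}\,\mathcal U(A^*A)\text{ and }\iota_f(B)=\iota_f(A)\}.$$ (b) If $\iota_i(A)\ge\iota_f(A)$, then $$\overline{\mathcal O}_U^U(A)=\{B\in\mathcal B(\mathcal H,\mathcal K): BB^*\in\overline{\mathcal O}\,\mathcal U(AA^* )\text{ and }\iota_i(B)=\iota_i(A)\}.$$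
   Context: Hilbert spaces are complex and of arbitrary dimension; $\dim$ is the Hilbert space dimension (the cardinality of an orthonormal basis), and sums of dimensions are cardinal sums. $\mathcal B(\mathcal H,\mathcal K)$ is the space of bounded linear operators $\mathcal H\to\mathcal K$ with the operator norm. $\mathcal U(\mathcal H)$ is the unitary group of $\mathcal H$. For a bounded operator $X$ on a Hilbert space $\mathcal H$, $\overline{\mathcal O}\,\mathcal U(X)$ is the norm closure of $\{UXU^{-1}: U\in\mathcal U(\mathcal H)\}$ (so for $A^*A$ one uses $\mathcal U(\mathcal H)$, for $AA^*$ one uses $\mathcal U(\mathcal K)$). $\mathcal N(A)$, $\mathcal R(A)$, $\overline{\mathcal R}(A)$ denote the kernel, the range and the closure of the range of $A$. For a pre-Hilbert space $\mathcal E$ with completion $\overline{\mathcal E}$, $\mathrm{IC}(\mathcal E)=\min\{\dim(\overline{\mathcal E}\ominus V): V \text{ a complete linear subspace of }\mathcal E\}$ ($\ominus$ denotes orthogonal complement). For $A\in\mathcal B(\mathcal H,\mathcal K)$: $\iota_i(A)=\dim\mathcal N(A)+\mathrm{IC}(\mathcal R(A))$ and $\iota_f(A)=\dim(\mathcal K\ominus\overline{\mathcal R}(A))+\mathrm{IC}(\mathcal R(A))$. *)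

(* Defs.v *)
From HB Require Import structures.
From mathcomp Require Import all_boot all_order all_algebra.
From mathcomp Require Import sesquilinear complex.
From mathcomp Require Import all_classical all_reals all_analysis.
Set Implicit Arguments.
Unset Strict Implicit.
Unset Printing Implicit Defensive.
Import Order.TTheory GRing.Theory Num.Theory.
Import numFieldNormedType.Exports.
Local Open Scope classical_set_scope.
Local Open Scope card_scope.
Local Open Scope complex_scope.
Local Open Scope ring_scope.

(* The inner product is linear in its first argument and conjugate-linear in
   its second one. *)
HB.mixin Record CompleteNormedModule_isHilbert (R : realType) (H : Type)
    & CompleteNormedModule R[i] H := {
  inner : {dot H for (@Num.conj R[i])};
  sqr_norm_inner : forall x : H, `|x| ^+ 2 = inner x x
}.

#[short(type="hilbertType")]
HB.structure Definition Hilbert (R : realType) :=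
  {H of CompleteNormedModule R[i] H & CompleteNormedModule_isHilbert R H}.

Section bounded_operators.
Variables (R : realType) (H K : hilbertType R).

Definition bounded_linear : {pred H -> K} :=
  [pred f : H -> K | `[< linear f /\
     exists M : R[i], forall x, `|f x| <= M * `|x| >] ].

Record bounded_op := BoundedOp {
  bounded_op_fun :> H -> K;
  _ : bounded_op_fun \in bounded_linear
}.

HB.instance Definition _ := [isSub for bounded_op_fun].
HB.instance Definition _ := [Choice of bounded_op by <:].

Lemma bounded_linearP (f : H -> K) : reflect
  (linear f /\ exists2 M : R, 0 <= M & forall x, `|f x| <= M%:C * `|x|)
  (f \in bounded_linear).
Proof.
apply: (iffP (asboolP _)) => -[lf [M]]; last first.
  by move=> M0 ?; split=> //; exists M%:C.
move=> fM; split=> //.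
exists (complex.Re `|M|) => [|x].
  by have := normr_ge0 M; rewrite lecE => /andP[].
rewrite RRe_real ?normr_real//.
rewrite -[X in _ * X](normr_id x) -normrM.
by rewrite (le_trans (fM x))// real_ler_norm// ger0_real// (le_trans _ (fM x)).
Qed.

Lemma bounded_linear_submod_closed : submod_closed bounded_linear.
Proof.
split=> [|a f g /bounded_linearP[lf [M M0 fM]] /bounded_linearP[lg [N N0 gN]]].
  apply/bounded_linearP; split=> [a x y|].
    by change (0 = a *: 0 + 0 :> K); rewrite scaler0 addr0.
  by exists 0 => // x; rewrite mul0r [leLHS](normr0 K).
have aE : (complex.Re `|a|)%:C = `|a| by rewrite RRe_real ?normr_real.
apply/bounded_linearP; split=> [b x y|].
  change (a *: f (b *: x + y) + g (b *: x + y) =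
    b *: (a *: f x + g x) + (a *: f y + g y)).
  rewrite lf lg !scalerDr !scalerA (mulrC a b) -!addrA.
  by congr (_ + _); rewrite addrCA.
exists (complex.Re `|a| * M + N) => [|x].
  by rewrite addr_ge0// mulr_ge0//; have := normr_ge0 a;
    rewrite lecE => /andP[].
change (`|a *: f x + g x| <= (complex.Re `|a| * M + N)%:C * `|x|).
rewrite (rmorphD (real_complex R)) (rmorphM (real_complex R))/= aE mulrDl.
rewrite (le_trans (ler_normD _ _))// lerD//.
by rewrite normrZ -mulrA ler_wpM2l.
Qed.

HB.instance Definition _ :=
  GRing.isSubmodClosed.Build _ _ bounded_linear bounded_linear_submod_closed.
HB.instance Definition _ := [SubChoice_isSubLmodule of bounded_op by <:].

Lemma bounded_op_linear (A : bounded_op) : linear A.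
Proof. by case: A => f /= /bounded_linearP[]. Qed.

HB.instance Definition _ (A : bounded_op) :=
  GRing.isLinear.Build _ _ _ _ A (@bounded_op_linear A).

(* The norm of a module over R[i] takes its values in R[i], hence the cast of
   the real number ||A||. *)
Definition opnorm (A : bounded_op) : R[i] :=
  (sup [set complex.Re `|A x| | x in [set x : H | `|x| <= 1]])%:C.

Lemma Re_normE (V : completeNormedModType R[i]) (x : V) :
  (complex.Re `|x|)%:C = `|x|.
Proof. by rewrite RRe_real ?normr_real. Qed.

Lemma opnorm_le (A : bounded_op) (M : R[i]) :
  (forall x, `|x| <= 1 -> `|A x| <= M) -> opnorm A <= M.
Proof.
move=> AM; have M0 : 0 <= M.
  by rewrite (le_trans (normr_ge0 (A 0)))// AM// normr0.
rewrite /opnorm -(RRe_real (ger0_real M0)) lecR.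
apply: ge_sup => [|_ [x /= x1 <-]].
  by exists (complex.Re `|A 0|), 0 => //=; rewrite normr0.
by rewrite -lecR Re_normE RRe_real ?ger0_real// AM.
Qed.

Lemma opnorm_ub1 (A : bounded_op) x : `|x| <= 1 -> `|A x| <= opnorm A.
Proof.
move=> x1; rewrite /opnorm -Re_normE lecR; apply: ub_le_sup; last by exists x.
have /bounded_linearP[_ [M M0 AM]] : (A : H -> K) \in bounded_linear.
  by case: (A).
exists M => _ [y /= y1 <-]; rewrite -lecR Re_normE (le_trans (AM y))//.
by rewrite ler_piMr// lecR.
Qed.

Lemma opnorm_ge0 A : 0 <= opnorm A.
Proof. by rewrite (le_trans (normr_ge0 (A 0)))// opnorm_ub1// normr0. Qed.

Lemma opnorm_ub (A : bounded_op) x : `|A x| <= opnorm A * `|x|.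
Proof.
have [->|x0] := eqVneq x 0; first by rewrite linear0 !normr0 mulr0.
have := @opnorm_ub1 A (`|x|^-1 *: x).
rewrite linearZ !normrZ normfV normr_id mulVf ?normr_eq0// => /(_ (lexx _)).
by rewrite mulrC ler_pdivrMr ?normr_gt0.
Qed.

Lemma opnormD A B : opnorm (A + B) <= opnorm A + opnorm B.
Proof.
apply: opnorm_le => x x1.
by rewrite (le_trans (ler_normD (A x) (B x)))// lerD// opnorm_ub1.
Qed.

Lemma opnormZ (a : R[i]) A : opnorm (a *: A) = `|a| * opnorm A.
Proof.
have le_opnormZ b B : opnorm (b *: B) <= `|b| * opnorm B.
  apply: opnorm_le => x x1.
  by rewrite [leLHS](normrZ b (B x)) ler_wpM2l// opnorm_ub1.
apply/eqP; rewrite eq_le le_opnormZ/=.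
have [->|a0] := eqVneq a 0; first by rewrite normr0 mul0r opnorm_ge0.
rewrite -ler_pdivlMl ?normr_gt0// -normfV.
by rewrite (le_trans _ (le_opnormZ _ _))// scalerA mulVf// scale1r.
Qed.

Lemma opnorm0_eq0 A : opnorm A = 0 -> A = 0.
Proof.
move=> A0; apply/val_inj/funext => x /=; apply/eqP; rewrite -normr_le0.
by rewrite (le_trans (opnorm_ub A x))// A0 mul0r.
Qed.

HB.instance Definition _ :=
  Lmodule_isNormed.Build R[i] bounded_op opnormD opnormZ opnorm0_eq0.

End bounded_operators.
Arguments bounded_op {R} H K.

Section operator_algebra.
Variables (R : realType) (H K L : hilbertType R).

Lemma bounded_comp_subproof (B : bounded_op K L) (A : bounded_op H K) :
  (B \o A : H -> L) \in @bounded_linear R H L.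
Proof.
apply/asboolP; split=> [a x y|]; first by rewrite /= !linearP.
exists (opnorm B * opnorm A) => x; rewrite -mulrA (le_trans (opnorm_ub B _))//.
by rewrite ler_wpM2l ?opnorm_ge0 ?opnorm_ub.
Qed.

Definition comp_op (B : bounded_op K L) (A : bounded_op H K) : bounded_op H L :=
  BoundedOp (bounded_comp_subproof B A).

End operator_algebra.

Section identity_operator.
Variables (R : realType) (H : hilbertType R).

Lemma bounded_id_subproof : (idfun : H -> H) \in @bounded_linear R H H.
Proof.
by apply/asboolP; split=> [a x y //|]; exists 1 => x; rewrite mul1r.
Qed.

Definition id_op : bounded_op H H := BoundedOp bounded_id_subproof.

End identity_operator.
Arguments id_op {R} H.

Section adjoint_inverse.
Variables (R : realType) (H K : hilbertType R).

(* There is exactly one such operator, by the Riesz representation theorem. *)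
Definition adjoint (A : bounded_op H K) : bounded_op K H :=
  xget 0 [set B : bounded_op K H | forall x y, inner (A x) y = inner x (B y)].

(* Meaningful for boundedly invertible operators only. *)
Definition inv_op (A : bounded_op H K) : bounded_op K H :=
  xget 0 [set B : bounded_op K H |
    comp_op B A = id_op H /\ comp_op A B = id_op K].

End adjoint_inverse.

Definition unitary (R : realType) (H : hilbertType R) :
    set (bounded_op H H) :=
  [set U | (forall x y, inner (U x) (U y) = inner x y) /\ range U = setT].

Section dimension.
Variables (R : realType) (H : hilbertType R).
Implicit Types B E V : set H.

Definition linear_subspace V :=
  V 0 /\ forall (a : R[i]) x y, V x -> V y -> V (a *: x + y).

Definition linear_span B : set H := smallest linear_subspace B.

Definition orthonormal_set B :=
  forall x y, B x -> B y -> inner x y = (x == y)%:R.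

Definition orthonormal_basis V : set (set H) :=
  [set B | orthonormal_set B /\ closure (linear_span B) = V].

(* Cardinals are represented by sets, to be compared with #<= and #= only.
   Every closed subspace V has an orthonormal basis, and any two of them are
   equipotent. *)
Definition hilbert_dim V : set H := xget set0 (orthonormal_basis V).

Definition ominus E V : set H :=
  [set x | E x /\ forall v, V v -> inner x v = 0].

Definition complete_set V := forall F : set_system H,
  ProperFilter F -> F V -> cauchy F -> exists2 x, V x & F --> x.

(* The pre-Hilbert space E is given as a linear subspace of the Hilbert space H,
   so that its completion is its closure in H. *)
Definition IC_codims E : set (set H) :=
  [set hilbert_dim (ominus (closure E) V) | V in
    [set V | [/\ linear_subspace V, V `<=` E & complete_set V]]].

(* The minimum exists since cardinals are well-ordered and {0} is a complete
   subspace of E. *)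
Definition IC E : set H :=
  xget set0 [set D | IC_codims E D /\ forall D', IC_codims E D' -> D #<= D'].

End dimension.

Definition card_sum (T U : Type) (A : set T) (B : set U) : set (T + U) :=
  inl @` A `|` inr @` B.

Section indices_and_orbits.
Variables (R : realType) (H K : hilbertType R).

Definition iota_i (A : bounded_op H K) : set (H + K) :=
  card_sum (hilbert_dim [set x | A x = 0]) (IC (range A)).

Definition iota_f (A : bounded_op H K) : set (K + K) :=
  card_sum (hilbert_dim (ominus setT (closure (range A)))) (IC (range A)).

Definition closed_orbit2 (A : bounded_op H K) : set (bounded_op H K) :=
  closure [set comp_op (comp_op V A) (inv_op U) |
           V in @unitary R K & U in @unitary R H].

Definition closed_unitary_orbit (X : bounded_op H H) : set (bounded_op H H) :=
  closure [set comp_op (comp_op U X) (inv_op U) | U in @unitary R H].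

End indices_and_orbits.

(* Main.v *)
Require Import Defs.
From mathcomp Require Import all_boot all_order all_algebra.
From mathcomp Require Import finmap sesquilinear complex.
From mathcomp Require Import all_classical all_reals all_analysis.
From mathcomp Require Import ring lra.
Set Implicit Arguments.
Unset Strict Implicit.
Unset Printing Implicit Defensive.
Import Order.TTheory GRing.Theory Num.Theory.
Import numFieldNormedType.Exports.
Local Open Scope classical_set_scope.
Local Open Scope card_scope.
Local Open Scope complex_scope.
Local Open Scope ring_scope.

(** The theorem rests on one description of the closed orbit: [B] is in the closure
    of [{V A U^-1}] if and only if [B^* B] is in the closed unitary orbit of
    [A^* A] and [iota_f B = iota_f A] ([closed_orbit2E]). Part (a) is this
    description, and part (b) is the same description for the adjoints, since
    [iota_i A = iota_f A^*] ([iota_i_adjoint]).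

    The index [iota_f A] is the least codimension of a closed subspace of the range
    of [A] ([iota_f_attained], [iota_f_le]). By the bounded inverse theorem
    ([closed_image_section]) such a subspace is the image of a closed subspace on
    which [A] is bounded below.

    If [B] is close to [V A U], then [B^* B] is close to [U^-1 (A^* A) U]
    ([gram_orbit]). Moreover [B] is still bounded below on the preimage of the
    optimal subspace of [A], and the codimension of the image does not grow; by
    symmetry [iota_f B = iota_f A] ([iota_f_semicontinuous], [iota_f_orbit]).

    Conversely, let [A1 = A U] with [A1^* A1] very close to [B^* B]. Cutting the
    space by [B^* B] at a small level gives a closed subspace [W] on which [A1] and
    [B] are bounded below, while both are small on its complement ([spectral_cut]).
    Below a certain level the images [A1 W] and [B W] have the least possible
    codimensions, namely [iota_f A] and [iota_f B] ([optimal_codim]). As these are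
    equal, the nearly isometric map [A1 w |-> B w] extends to a nearly isometric
    bijection of [K], whose polar factor is a unitary [V] with [V A1] close to [B]
    ([unitary_match], [orbit_of_gram]).

    The spectral cut and the polar factor only need square roots of operators at
    distance at most 1 from the identity, which are limits of an explicit iteration
    ([exists_sqrt]). Dimensions are compared through the principle that [dim X <=
    dim Y] whenever a bounded operator pairs [X] with [Y] without kernel in [X]
    ([hilbert_dim_le]). *)

(** * Inner products, real-valued norms and convergent sequences *)

Section norm.
Variables (R : realType) (H : hilbertType R).
Implicit Types x y z : H.

Lemma innerC x y : inner y x = (inner x y)^*.
Proof. by rewrite hermC expr0 mul1r. Qed.
Lemma innerDl x y z : inner (x + y) z = inner x z + inner y z.
Proof. exact: linearDl. Qed.
Lemma innerDr x y z : inner z (x + y) = inner z x + inner z y.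
Proof. exact: linearDr. Qed.
Lemma innerBl x y z : inner (x - y) z = inner x z - inner y z.
Proof. exact: linearBl. Qed.
Lemma innerBr x y z : inner z (x - y) = inner z x - inner z y.
Proof. exact: linearBr. Qed.
Lemma innerZl (a : R[i]) x z : inner (a *: x) z = a * inner x z.
Proof. exact: linearZl_LR. Qed.
Lemma innerZr (a : R[i]) x z : inner z (a *: x) = a^* * inner z x.
Proof. exact: linearZr_LR. Qed.
Lemma inner0l z : inner 0 z = 0 :> R[i].
Proof. exact: linear0l. Qed.
Lemma inner0r z : inner z 0 = 0 :> R[i].
Proof. exact: linear0r. Qed.
Lemma innerNl x z : inner (- x) z = - inner x z.
Proof. exact: linearNl. Qed.

Lemma inner_sym0 x y : inner x y = 0 -> inner y x = 0.
Proof. by move=> xy0; rewrite innerC xy0 rmorph0. Qed.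

Definition cabs (a : R[i]) : R := complex.Re `|a|.
(** Norms take their values in [R[i]], which is only partially ordered;
    [cabs] and [nrm] bring the estimates back to the ordered field [R]. *)
Definition nrm x : R := complex.Re `|x|.

Lemma cabsE (a : R[i]) : (cabs a)%:C = `|a|.
Proof. by rewrite /cabs RRe_real ?normr_real. Qed.
Lemma nrmE x : (nrm x)%:C = `|x|.
Proof. by rewrite /nrm RRe_real ?normr_real. Qed.

Lemma cabs_ge0 (a : R[i]) : 0 <= cabs a.
Proof. by rewrite -lecR cabsE normr_ge0. Qed.
Lemma cabs0 : cabs 0 = 0.
Proof. by rewrite /cabs normr0. Qed.
Lemma cabs_eq0 (a : R[i]) : cabs a = 0 -> a = 0.
Proof. by move=> a0; apply/normr0_eq0; rewrite -cabsE a0. Qed.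
Lemma cabsM (a b : R[i]) : cabs (a * b) = cabs a * cabs b.
Proof. by apply: complexI; rewrite rmorphM/= !cabsE normrM. Qed.
Lemma cabsN (a : R[i]) : cabs (- a) = cabs a.
Proof. by rewrite /cabs normrN. Qed.
Lemma cabsD (a b : R[i]) : cabs (a + b) <= cabs a + cabs b.
Proof. by rewrite -lecR rmorphD/= !cabsE ler_normD. Qed.
Lemma cabs_ge_Re (a : R[i]) : `|complex.Re a| <= cabs a.
Proof. by rewrite -lecR cabsE; exact: normc_ge_Re. Qed.
Lemma cabs_real (r : R) : 0 <= r -> cabs r%:C = r.
Proof. by move=> r0; apply: complexI; rewrite cabsE ger0_norm// lecR. Qed.

Lemma nrm_ge0 x : 0 <= nrm x.
Proof. by rewrite -lecR nrmE normr_ge0. Qed.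
Lemma nrm0 : nrm 0 = 0.
Proof. by rewrite /nrm normr0. Qed.
Lemma nrm_eq0 x : nrm x = 0 -> x = 0.
Proof. by move=> a0; apply/normr0_eq0; rewrite -nrmE a0. Qed.
Lemma nrm_gt0 x : x != 0 -> 0 < nrm x.
Proof.
move=> x0; rewrite lt_neqAle nrm_ge0 andbT eq_sym.
by apply: contra_neq x0; exact: nrm_eq0.
Qed.
Lemma nrmZ (a : R[i]) x : nrm (a *: x) = cabs a * nrm x.
Proof. by apply: complexI; rewrite rmorphM/= !(cabsE, nrmE) normrZ. Qed.
Lemma nrmN x : nrm (- x) = nrm x.
Proof. by rewrite /nrm normrN. Qed.
Lemma nrmD x y : nrm (x + y) <= nrm x + nrm y.
Proof. by rewrite -lecR rmorphD/= !nrmE ler_normD. Qed.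
Lemma nrmB x y : nrm (x - y) <= nrm x + nrm y.
Proof. by rewrite -(nrmN y) nrmD. Qed.
Lemma nrm_subC x y : nrm (x - y) = nrm (y - x).
Proof. by rewrite -nrmN opprB. Qed.
Lemma nrm_tri z x y : nrm (x - y) <= nrm (x - z) + nrm (z - y).
Proof. by rewrite -{1}(subrK z x) -addrA; exact: nrmD. Qed.
Lemma nrm_ge_sub x y : nrm x - nrm y <= nrm (x - y).
Proof. by rewrite lerBlDr; have := nrmD (x - y) y; rewrite subrK. Qed.

Definition re_inner x y : R := complex.Re (inner x y).

Lemma inner_nrm x : inner x x = (nrm x ^+ 2)%:C.
Proof. by rewrite rmorphXn/= nrmE sqr_norm_inner. Qed.
Lemma re_innerxx x : re_inner x x = nrm x ^+ 2.
Proof. by rewrite /re_inner inner_nrm. Qed.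
Lemma re_innerC x y : re_inner y x = re_inner x y.
Proof. by rewrite /re_inner innerC; case: (inner x y). Qed.
Lemma re_innerDl x y z : re_inner (x + y) z = re_inner x z + re_inner y z.
Proof. by rewrite /re_inner innerDl; case: (inner x z) (inner y z) => ? ? []. Qed.
Lemma re_innerDr x y z : re_inner z (x + y) = re_inner z x + re_inner z y.
Proof. by rewrite !(re_innerC _ z) re_innerDl. Qed.
Lemma re_innerNl x z : re_inner (- x) z = - re_inner x z.
Proof. by rewrite /re_inner innerNl; case: (inner x z). Qed.
Lemma re_innerNr x z : re_inner z (- x) = - re_inner z x.
Proof. by rewrite !(re_innerC _ z) re_innerNl. Qed.
Lemma re_innerZl (a : R) x z : re_inner (a%:C *: x) z = a * re_inner x z.
Proof. by rewrite /re_inner innerZl; case: (inner x z) => u v /=; rewrite mul0r subr0. Qed.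
Lemma re_inner0 x y : inner x y = 0 -> re_inner x y = 0.
Proof. by rewrite /re_inner => ->. Qed.
Lemma nrm2D x y : nrm (x + y) ^+ 2 = nrm x ^+ 2 + nrm y ^+ 2 + 2 * re_inner x y.
Proof. by rewrite -!re_innerxx re_innerDl !re_innerDr (re_innerC x y); ring. Qed.
Lemma nrm2B x y : nrm (x - y) ^+ 2 = nrm x ^+ 2 + nrm y ^+ 2 - 2 * re_inner x y.
Proof. by rewrite nrm2D nrmN re_innerNr; ring. Qed.

(** Pythagoras for the decomposition of [x] into its component along [y] and the
    component orthogonal to [y]. *)
Lemma cauchy_schwarz x y : cabs (inner x y) <= nrm x * nrm y.
Proof.
have [->|y0] := eqVneq y 0; first by rewrite inner0r cabs0 nrm0 mulr0.
have ny : 0 < nrm y := nrm_gt0 y0.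
set a := inner x y; set c := a / (nrm y ^+ 2)%:C.
have nc : (nrm y ^+ 2)%:C != 0 :> R[i].
  by apply/negP => /eqP/complexI/eqP; rewrite expf_eq0/= gt_eqF.
have o : inner (x - c *: y) y = 0.
  by rewrite innerBl innerZl inner_nrm mulfVK// subrr.
have := nrm2D (x - c *: y) (c *: y).
rewrite subrK (re_inner0 (x := x - c *: y)); last by rewrite innerZr o mulr0.
rewrite mulr0 addr0 nrmZ => e.
have cE : cabs a = cabs c * nrm y ^+ 2.
  rewrite -{1}(mulfVK nc a) cabsM -/c; congr (_ * _).
  by rewrite cabs_real// sqr_ge0.
rewrite cE -(@ler_pXn2r _ 2)// ?nnegrE ?mulr_ge0 ?nrm_ge0 ?cabs_ge0//.
rewrite [leRHS]exprMn e.
have -> : (cabs c * nrm y ^+ 2) ^+ 2 = (cabs c * nrm y) ^+ 2 * nrm y ^+ 2 by ring.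
by rewrite ler_wpM2r ?sqr_ge0// lerDr sqr_ge0.
Qed.

Lemma cabs_small0 (a : R[i]) : (forall e : R, 0 < e -> cabs a <= e) -> a = 0.
Proof.
move=> h; apply/cabs_eq0/eqP; rewrite eq_le cabs_ge0 andbT.
by apply/ler_addgt0Pr => e e0; rewrite add0r h.
Qed.

Lemma re_inner_le x y : `|re_inner x y| <= nrm x * nrm y.
Proof. by rewrite (le_trans (cabs_ge_Re _))// cauchy_schwarz. Qed.

Lemma parallelogram x y :
  nrm (x + y) ^+ 2 + nrm (x - y) ^+ 2 = 2 * nrm x ^+ 2 + 2 * nrm y ^+ 2.
Proof. by rewrite nrm2D nrm2B; ring. Qed.

Lemma ball_nrm x y (e : R) : ball x e%:C y <-> nrm (x - y) < e.
Proof. by rewrite -ball_normE/= /ball_ -nrmE ltcR. Qed.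

Lemma pos_real (e : R[i]) : 0 < e -> e = (complex.Re e)%:C /\ 0 < complex.Re e.
Proof.
by move=> e0; rewrite -ltcR RRe_real// gtr0_real.
Qed.

Lemma closure_nrm (A : set H) x :
  closure A x <-> forall e : R, 0 < e -> exists2 y, A y & nrm (x - y) < e.
Proof.
split=> [cA e e0|h B].
  have /cA[y [Ay /ball_nrm xy]] : nbhs x (ball x e%:C).
    by apply: nbhsx_ballx; rewrite ltcR.
  by exists y.
move=> /nbhs_ballP[e /= /pos_real[-> e0] eB].
have [y Ay xy] := h _ e0.
by exists y; split=> //; apply: eB; exact/ball_nrm.
Qed.

Definition norm_cvg (u : nat -> H) l :=
  forall e : R, 0 < e -> exists N, forall n, (N <= n)%N -> nrm (u n - l) < e.

Definition norm_cauchy (u : nat -> H) :=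
  forall e : R, 0 < e ->
    exists N, forall m n, (N <= m)%N -> (N <= n)%N -> nrm (u m - u n) < e.

Lemma norm_cauchy_cvg u : norm_cauchy u -> exists l, norm_cvg u l.
Proof.
move=> cu.
have /cauchy_cvgP cvu : cauchy (u @ \oo).
  apply/cauchy_ballP => e /= /pos_real[-> e0].
  have [N uN] := cu _ e0.
  exists (u @` [set n | (N <= n)%N], u @` [set n | (N <= n)%N]).
    by split; exists N => // n /= Nn; exists n.
  by move=> [_ _] [[m /= Nm <-] [n /= Nn <-]]; apply/ball_nrm/uN.
exists (lim (u @ \oo)) => e e0.
have /cvu[N _ NP] : nbhs (lim (u @ \oo)) (ball (lim (u @ \oo)) e%:C).
  by apply: nbhsx_ballx; rewrite ltcR.
by exists N => n /NP /= /ball_nrm; rewrite nrm_subC.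
Qed.

Lemma norm_cvg_unique u l l' : norm_cvg u l -> norm_cvg u l' -> l = l'.
Proof.
move=> ul ul'; apply/eqP; rewrite -subr_eq0; apply/negPn/negP => /nrm_gt0 d.
have [|N h] := ul (nrm (l - l') / 2); first by lra.
have [|N' h'] := ul' (nrm (l - l') / 2); first by lra.
have := h (maxn N N') (leq_maxl _ _); have := h' (maxn N N') (leq_maxr _ _).
by have := nrm_tri (u (maxn N N')) l l'; rewrite (nrm_subC l (u _)); lra.
Qed.

Lemma norm_cvgD u v l m : norm_cvg u l -> norm_cvg v m -> norm_cvg (fun n => u n + v n) (l + m).
Proof.
move=> ul vm e e0.
have [|N h] := ul (e / 2); first by lra.
have [|M h'] := vm (e / 2); first by lra.
exists (maxn N M) => n; rewrite geq_max => /andP[/h a /h' b].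
by have := nrmD (u n - l) (v n - m); rewrite addrACA -opprD; lra.
Qed.

Lemma norm_cvg_cst l : norm_cvg (fun=> l) l.
Proof. by move=> e e0; exists 0%N => n _; rewrite subrr nrm0. Qed.

Lemma norm_cvg_nrm_le u l (c : R) : norm_cvg u l ->
  (exists N, forall n, (N <= n)%N -> nrm (u n) <= c) -> nrm l <= c.
Proof.
move=> ul [N uc]; apply/ler_addgt0Pr => e e0.
have [M h] := ul _ e0.
have := h _ (leq_maxr N M); have := uc _ (leq_maxl N M).
by have := nrm_ge_sub l (u (maxn N M)); rewrite nrm_subC; lra.
Qed.

Lemma norm_cvg_shift u l k : norm_cvg u l -> norm_cvg (fun n => u (n + k)%N) l.
Proof.
move=> ul e e0; have [N h] := ul _ e0; exists N => n Nn.
by apply: h; rewrite (leq_trans Nn)// leq_addr.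
Qed.

End norm.

Section norm2.
Variables (R : realType) (H K : hilbertType R).

Lemma nrm_of_inner (x : H) (y : K) : inner x x = inner y y -> nrm x = nrm y.
Proof.
rewrite !inner_nrm => /complexI h.
by apply/eqP; rewrite -(@eqrXn2 _ 2)// ?nrm_ge0// h.
Qed.

Lemma norm_cvg_lin (f : H -> K) (M : R) u l : linear f ->
  (forall x, nrm (f x) <= M * nrm x) -> norm_cvg u l -> norm_cvg (f \o u) (f l).
Proof.
move=> lf fM ul e e0.
have fB x y : f (x - y) = f x - f y.
  by rewrite addrC -scaleN1r lf scaleN1r addrC.
have M0 : 0 < `|M| + 1 by have := normr_ge0 M; lra.
have [|N h] := ul (e / (`|M| + 1)); first by rewrite divr_gt0.
exists N => n /h; rewrite /= ltr_pdivlMr// => d.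
rewrite -fB.
have := fM (u n - l); have := nrm_ge0 (u n - l).
have := ler_norm M; move: d.
nra.
Qed.

End norm2.

(** * Closed subspaces and orthogonal projections *)

Section subspaces.
Variables (R : realType) (H : hilbertType R).
Implicit Types (x y z v : H) (V W : set H).

Lemma lsub0 V : linear_subspace V -> V 0.
Proof. by case. Qed.
Lemma lsubZD V (a : R[i]) x y : linear_subspace V -> V x -> V y -> V (a *: x + y).
Proof. by case=> _; apply. Qed.
Lemma lsubD V x y : linear_subspace V -> V x -> V y -> V (x + y).
Proof. by move=> lV Vx Vy; rewrite -(scale1r x); exact: lsubZD. Qed.
Lemma lsubZ V (a : R[i]) x : linear_subspace V -> V x -> V (a *: x).
Proof. by move=> lV Vx; rewrite -(addr0 (a *: x)); apply: lsubZD => //; exact: lsub0. Qed.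
Lemma lsubN V x : linear_subspace V -> V x -> V (- x).
Proof. by move=> lV Vx; rewrite -scaleN1r; exact: lsubZ. Qed.
Lemma lsubB V x y : linear_subspace V -> V x -> V y -> V (x - y).
Proof. by move=> lV Vx Vy; apply: lsubD => //; exact: lsubN. Qed.

Definition closed_subspace V := linear_subspace V /\ closure V `<=` V.

Lemma closed_subspace_lim V (u : nat -> H) l : closed_subspace V ->
  (forall n, V (u n)) -> norm_cvg u l -> V l.
Proof.
move=> [_ cV] Vu ul; apply/cV/closure_nrm => e /ul[N /(_ N (leqnn N)) h].
by exists (u N) => //; rewrite nrm_subC.
Qed.

Lemma closure_idem V : closure (closure V) `<=` closure V.
Proof.
move=> x /closure_nrm h; apply/closure_nrm => e e0.
have [|y /closure_nrm h' xy] := h (e / 2); first by lra.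
have [|z Vz yz] := h' (e / 2); first by lra.
by exists z => //; have := nrm_tri y x z; lra.
Qed.

Lemma closure_closed_subspace V :
  linear_subspace V -> closed_subspace (closure V).
Proof.
move=> lV; split; last exact: closure_idem.
split=> [|a x y /closure_nrm hx /closure_nrm hy]; first by apply: subset_closure; exact: lsub0.
apply/closure_nrm => e e0.
have a0 := cabs_ge0 a.
have [|x' Vx' xx'] := hx (e / 2 / (cabs a + 1)); first by rewrite !divr_gt0//; lra.
have [|y' Vy' yy'] := hy (e / 2); first by lra.
exists (a *: x' + y'); first exact: lsubZD.
rewrite opprD addrACA -scalerBr.
have := nrmD (a *: (x - x')) (y - y'); rewrite nrmZ.
move: xx'; rewrite ltr_pdivlMr; last by lra.
have := nrm_ge0 (x - x'); nra.
Qed.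

Definition perp V : set H := ominus setT V.

Lemma perpP V x : perp V x <-> forall v, V v -> inner x v = 0.
Proof. by split=> [[]|]//. Qed.

Lemma ominus_linear (E V : set H) :
  linear_subspace E -> linear_subspace (ominus E V).
Proof.
move=> lE; split=> [|a x y [Ex xV] [Ey yV]].
  by split=> [|v _]; [exact: lsub0|rewrite inner0l].
split=> [|v Vv]; first exact: lsubZD.
by rewrite innerDl innerZl xV// yV// mulr0 addr0.
Qed.

Lemma inner_closure (A : set H) x y : closure A x ->
  (forall a, A a -> inner a y = 0) -> inner x y = 0.
Proof.
move=> /closure_nrm cx Ay; apply: cabs_small0 => e e0.
have y1 : 0 < nrm y + 1 by have := nrm_ge0 y; lra.
have [|a /Ay ay] := cx (e / (nrm y + 1)); first by rewrite divr_gt0.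
rewrite ltr_pdivlMr//.
have := cauchy_schwarz (x - a) y; rewrite innerBl ay subr0.
by have := nrm_ge0 (x - a); have := nrm_ge0 y; nra.
Qed.

Lemma ominus_closed (E V : set H) :
  closed_subspace E -> closed_subspace (ominus E V).
Proof.
move=> [lE cE]; split; first exact: ominus_linear.
move=> x cx; split=> [|v Vv].
  by apply: cE; apply: closure_subset cx => y [].
by apply: inner_closure cx _ => a [_]; apply.
Qed.

Lemma setT_closed_subspace : closed_subspace (setT : set H).
Proof. by []. Qed.

Lemma perp_closed V : closed_subspace (perp V).
Proof. exact/ominus_closed/setT_closed_subspace. Qed.

Lemma perp_linear V : linear_subspace (perp V).
Proof. by case: (perp_closed V). Qed.

Lemma perp_closure V : perp (closure V) = perp V.
Proof.
apply/seteqP; split=> x /perpP h; apply/perpP => v Vv.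
  exact/h/subset_closure.
by apply: inner_sym0; apply: inner_closure Vv _ => a /h; exact: inner_sym0.
Qed.

(** A nearest point of a subspace is an orthogonal projection: moving [p] by the
    small multiple [t * a] of [v], with [a] the inner product of [x - p] and [v],
    would otherwise shorten the distance. *)
Lemma min_perp V x p : linear_subspace V -> V p ->
  (forall v, V v -> nrm (x - p) <= nrm (x - v)) ->
  forall v, V v -> inner (x - p) v = 0.
Proof.
move=> lV Vp hmin v Vv; set w := x - p; set a := inner w v.
have nv := nrm_ge0 v.
pose t : R := (nrm v ^+ 2 + 1)^-1.
have t0 : 0 < t by rewrite invr_gt0; have := sqr_ge0 (nrm v); lra.
have := hmin (p + (t%:C * a) *: v) (lsubD lV Vp (lsubZ _ lV Vv)).
rewrite opprD addrA -/w -(@ler_pXn2r _ 2)// ?nnegrE ?nrm_ge0//.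
rewrite [leRHS]nrm2B nrmZ cabsM cabs_real ?(ltW t0)//.
have -> : re_inner w ((t%:C * a) *: v) = t * cabs a ^+ 2.
  rewrite /re_inner innerZr -/a rmorphM/=.
  have -> : (t%:C)^* = t%:C :> R[i] by rewrite conj_Creal// complex_real.
  by rewrite -mulrA (mulrC _ a) -normCK -cabsE -rmorphXn/= mul0r subr0.
have tE : t * (nrm v ^+ 2 + 1) = 1.
  by rewrite mulVf// gt_eqF// -invr_gt0.
move=> h; apply: cabs_eq0; apply/eqP; rewrite -sqrf_eq0 eq_le sqr_ge0 andbT.
have := sqr_ge0 (cabs a); have := sqr_ge0 (nrm v); nra.
Qed.

(** A sequence in [V] whose distances to [x] tend to the infimum is Cauchy by the
    parallelogram law, since the midpoints of its terms are in [V] as well. *)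
Lemma exists_proj V x : closed_subspace V ->
  exists p, V p /\ forall v, V v -> inner (x - p) v = 0.
Proof.
move=> cV; have lV := cV.1.
pose D := [set nrm (x - v) ^+ 2 | v in V].
have D0 : D (nrm (x - 0) ^+ 2) by exists 0 => //; exact: lsub0.
have Dlb : has_lbound D by exists 0 => _ [v _ <-]; exact: sqr_ge0.
have Dinf : has_inf D by split=> //; exists (nrm (x - 0) ^+ 2).
pose d := inf D.
have dle v : V v -> d <= nrm (x - v) ^+ 2.
  by move=> Vv; apply: ge_inf => //; exists v.
have /choice[u uP] n : exists v, V v /\ nrm (x - v) ^+ 2 < d + n.+1%:R^-1.
  have [_ [v Vv <-] h] := @inf_adherent _ D n.+1%:R^-1 (ltac:(by [])) Dinf.
  by exists v.
have cu : norm_cauchy u.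
  move=> e e0.
  have [N _ hN] := near_infty_natSinv_lt (PosNum (divr_gt0 (exprn_gt0 2 e0) (ltr0n R 4))).
  exists N => m n /hN/= hm /hN/= hn.
  have [[Vm um] [Vn un]] := (uP m, uP n).
  have := parallelogram (x - u m) (x - u n).
  have -> : x - u m + (x - u n) = 2%:R%:C *: (x - 2^-1%:C *: (u m + u n)).
    rewrite scalerBr scalerA -rmorphM/= mulfV ?pnatr_eq0// scale1r.
    by rewrite addrACA -opprD -mulr2n -scaler_nat rmorph_nat.
  rewrite nrmZ cabs_real ?ler0n// exprMn.
  have -> : x - u m - (x - u n) = u n - u m by rewrite opprB addrC addrA subrK addrC.
  have := dle (2^-1%:C *: (u m + u n)) (lsubZ _ lV (lsubD lV Vm Vn)).
  move=> h1 h2.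
  rewrite -(@ltr_pXn2r _ 2)// ?nnegrE ?nrm_ge0// ?(ltW e0)// nrm_subC.
  move: hm hn um un; set P := nrm _ ^+ 2 in h1 h2 *; set a := n.+1%:R^-1; set b := m.+1%:R^-1.
  move: h1 h2; rewrite /=; lra.
have [p up] := norm_cauchy_cvg cu.
exists p; have Vp : V p by apply: closed_subspace_lim cV _ up => n; exact: (uP n).1.
split=> //; apply: min_perp => // v Vv.
apply/ler_addgt0Pr => e e0.
have [N h] := up (e / 2) ltac:(lra).
have [M _ hM] := near_infty_natSinv_lt (PosNum (exprn_gt0 2 (divr_gt0 e0 (ltr0n R 2)))).
have := h _ (leq_maxl N M); have /= := hM (maxn N M) (leq_maxr _ _).
set n := maxn N M => h1 h2.
have := (uP n).2; have := dle _ Vv => h3 h4.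
have := nrm_tri (u n) x p.
have : nrm (x - u n) < nrm (x - v) + e / 2.
  rewrite -(@ltr_pXn2r _ 2)// ?nnegrE ?nrm_ge0//; last by rewrite addr_ge0 ?nrm_ge0//; lra.
  move: h1 h3 h4; have := mulr_ge0 (nrm_ge0 (x - v)) (ltW e0).
  by set a := _^-1; lra.
lra.
Qed.

Definition proj V x := xget 0 [set p | V p /\ forall v, V v -> inner (x - p) v = 0].

Lemma projP V x : closed_subspace V ->
  V (proj V x) /\ forall v, V v -> inner (x - proj V x) v = 0.
Proof. by move=> /exists_proj-/(_ x)[p pP]; rewrite /proj; case: xgetP => // /(_ p). Qed.

Lemma proj_in V x : closed_subspace V -> V (proj V x).
Proof. by move=> /(projP x)[]. Qed.

Lemma proj_perp V x : closed_subspace V -> perp V (x - proj V x).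
Proof. by move=> /(projP x)[_ h]; apply/perpP. Qed.

Lemma proj_uniq V x p : closed_subspace V -> V p -> perp V (x - p) ->
  proj V x = p.
Proof.
move=> cV Vp /perpP h; have [Vq q] := projP x cV.
apply/eqP; rewrite -subr_eq0; apply/eqP/nrm_eq0/eqP; rewrite -sqrf_eq0 -re_innerxx.
have Vpq : V (proj V x - p) by apply: lsubB => //; exact: cV.1.
have e : proj V x - p = (x - p) - (x - proj V x) by rewrite opprB [RHS]addrC subrKA.
rewrite /re_inner {1}e innerBl.
by rewrite h// q// subr0.
Qed.

Lemma proj_id V x : closed_subspace V -> V x -> proj V x = x.
Proof.
move=> cV Vx; apply: proj_uniq => //; rewrite subrr.
by apply: lsub0; exact: perp_linear.
Qed.

Lemma proj_perp0 V x : closed_subspace V -> perp V x -> proj V x = 0.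
Proof.
move=> cV Vx; apply: proj_uniq => //; rewrite ?subr0//.
by apply: lsub0; exact: cV.1.
Qed.

Lemma proj_linear V : closed_subspace V -> linear (proj V).
Proof.
move=> cV a x y; apply: proj_uniq => //.
  by apply: lsubZD; [exact: cV.1|exact: proj_in..].
rewrite opprD addrACA -scalerBr.
by apply: lsubZD; [exact: perp_linear|exact: proj_perp..].
Qed.

Lemma pythagoras x y : inner x y = 0 ->
  nrm (x + y) ^+ 2 = nrm x ^+ 2 + nrm y ^+ 2.
Proof. by move=> xy; rewrite nrm2D re_inner0// mulr0 addr0. Qed.

Lemma nrm_proj_le V x : closed_subspace V -> nrm (proj V x) <= nrm x.
Proof.
move=> cV; rewrite -(@ler_pXn2r _ 2)// ?nnegrE ?nrm_ge0//.
rewrite -[in leRHS](subrK (proj V x) x) pythagoras ?lerDr ?sqr_ge0//.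
by move/perpP : (proj_perp x cV); apply; exact: proj_in.
Qed.

Lemma perp_perp V : closed_subspace V -> perp (perp V) = V.
Proof.
move=> cV; apply/seteqP; split=> x.
  move=> /perpP h; rewrite -(subrK (proj V x) x).
  have o : inner (x - proj V x) (x - proj V x) = 0.
    rewrite innerBl h ?sub0r; last exact: proj_perp.
    rewrite inner_sym0 ?oppr0//.
    by move/perpP : (proj_perp x cV); apply; exact: proj_in.
  have -> : x - proj V x = 0.
    by apply/nrm_eq0/eqP; rewrite -sqrf_eq0 -re_innerxx re_inner0.
  by rewrite add0r; exact: proj_in.
move=> Vx; apply/perpP => v /perpP Vv; apply: inner_sym0; exact: Vv.
Qed.

Lemma inner_self0 x : inner x x = 0 -> x = 0.
Proof. by move=> o; apply/nrm_eq0/eqP; rewrite -sqrf_eq0 -re_innerxx re_inner0. Qed.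

Lemma perp_self0 V x : V x -> perp V x -> x = 0.
Proof. by move=> Vx /perpP/(_ _ Vx)/inner_self0. Qed.

End subspaces.

(** * Bounded operators and adjoints *)

Section operators.
Variables (R : realType).

Lemma exists_op (H K : hilbertType R) (f : H -> K) (M : R) : linear f ->
  (forall x, nrm (f x) <= M * nrm x) ->
  exists A : bounded_op H K, forall x, A x = f x.
Proof.
move=> lf fM.
suff h : f \in @bounded_linear R H K by exists (BoundedOp h).
apply/bounded_linearP; split=> //; exists `|M| => // x.
rewrite -!nrmE -rmorphM/= lecR (le_trans (fM x))//.
by rewrite ler_wpM2r ?nrm_ge0// ler_norm.
Qed.

Definition op_nrm (H K : hilbertType R) (A : bounded_op H K) : R := complex.Re (opnorm A).

Lemma op_nrmE (H K : hilbertType R) (A : bounded_op H K) : (op_nrm A)%:C = opnorm A.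
Proof. by []. Qed.

Lemma nrm_op (H K : hilbertType R) (A : bounded_op H K) x : nrm (A x) <= op_nrm A * nrm x.
Proof. by rewrite -lecR rmorphM/= !nrmE op_nrmE opnorm_ub. Qed.

Lemma op_nrm_le (H K : hilbertType R) (A : bounded_op H K) (M : R) : 0 <= M ->
  (forall x, nrm (A x) <= M * nrm x) -> op_nrm A <= M.
Proof.
move=> M0 h; rewrite -lecR op_nrmE; apply: opnorm_le => x x1.
rewrite -nrmE lecR (le_trans (h x))// ler_piMr//.
by rewrite -lecR nrmE.
Qed.

Lemma op_nrm_ge0 (H K : hilbertType R) (A : bounded_op H K) : 0 <= op_nrm A.
Proof. by rewrite -lecR op_nrmE opnorm_ge0. Qed.

(** Membership in a closure for the operator norm, in terms of vectors only; all
    later estimates are done pointwise. *)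
Lemma closure_op (H K : hilbertType R) (S : set (bounded_op H K)) B :
  closure S B <-> forall e : R, 0 < e -> exists2 A, S A &
    forall x, nrm (B x - A x) <= e * nrm x.
Proof.
split=> [cS e e0|h T].
  have /cS[A [SA BA]] : nbhs B (ball B e%:C).
    by apply: nbhsx_ballx; rewrite ltcR.
  exists A => // x; move: BA; rewrite -ball_normE/= /ball_ /=.
  change (opnorm (B - A) < e%:C -> nrm ((B - A) x) <= e * nrm x).
  rewrite -op_nrmE ltcR => /ltW h; rewrite (le_trans (nrm_op _ _))//.
  by rewrite ler_wpM2r ?nrm_ge0.
move=> /nbhs_ballP[e /= /pos_real[-> e0] eB].
have [|A SA BA] := h (complex.Re e / 2); first by lra.
exists A; split=> //; apply: eB; rewrite -ball_normE/= /ball_ /=.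
change (opnorm (B - A) < (complex.Re e)%:C); rewrite -op_nrmE ltcR.
have : op_nrm (B - A) <= complex.Re e / 2 by apply: op_nrm_le => //; lra.
lra.
Qed.

(** A nonzero bounded functional is represented by a multiple of any nonzero vector
    orthogonal to its kernel. *)
Lemma riesz (H : hilbertType R) (phi : H -> R[i]) (M : R) : linear_for *%R phi ->
  (forall x, cabs (phi x) <= M * nrm x) ->
  exists y, forall x, phi x = inner x y.
Proof.
move=> lphi phiM.
have p0 : phi 0 = 0.
  by apply/cabs_eq0/eqP; rewrite eq_le cabs_ge0 andbT (le_trans (phiM 0))// nrm0 mulr0.
have pZ a x : phi (a *: x) = a * phi x by rewrite -(addr0 (a *: x)) lphi p0 addr0.
have pB x y : phi (x - y) = phi x - phi y.
  by rewrite addrC -scaleN1r lphi mulN1r addrC.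
pose N := [set x | phi x = 0].
have cN : closed_subspace N.
  split=> [|x /closure_nrm cx].
    by split=> [|a x y]; rewrite /N /= ?p0// lphi => -> ->; rewrite mulr0 addr0.
  apply: cabs_small0 => e e0.
  have M0 : 0 < `|M| + 1 by have := normr_ge0 M; lra.
  have [|y Ny] := cx (e / (`|M| + 1)); first by rewrite divr_gt0.
  rewrite ltr_pdivlMr// => xy.
  have := phiM (x - y).
  rewrite pB Ny subr0; have := ler_norm M; have := nrm_ge0 (x - y); nra.
have [[x0 /eqP x0N]|allN] := pselect (exists x, phi x <> 0); last first.
  by exists 0 => x; rewrite inner0r; apply: contrapT => ?; apply: allN; exists x.
pose z := x0 - proj N x0.
have fz : phi z != 0 by rewrite pB (proj_in x0 cN : phi _ = 0) subr0.
have z0 : inner z z != 0.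
  by apply: contra_neq fz => /inner_self0 ->.
exists ((phi z / inner z z)^* *: z) => x; rewrite innerZr conjCK.
have : inner (phi z *: x - phi x *: z) z = 0.
  apply: inner_sym0; move/perpP : (proj_perp x0 cN); apply.
  by rewrite /N/= pB !pZ mulrC subrr.
rewrite innerBl !innerZl => /eqP; rewrite subr_eq0 => /eqP e.
by rewrite mulrAC e mulfK.
Qed.

Lemma exists_adjoint (H K : hilbertType R) (A : bounded_op H K) :
  exists B : bounded_op K H, forall x y, inner (A x) y = inner x (B y).
Proof.
have /choice[b bP] (y : K) : exists z : H, forall x, inner (A x) y = inner x z.
  apply: (@riesz _ _ (op_nrm A * nrm y)) => [a u v|x].
    by rewrite linearP innerDl innerZl.
  rewrite (le_trans (cauchy_schwarz _ _))// mulrAC.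
  by rewrite ler_wpM2r ?nrm_ge0// nrm_op.
have [|x|B BE] := @exists_op _ _ b (op_nrm A).
- move=> a u v; apply/eqP; rewrite -subr_eq0; apply/eqP/inner_self0.
  set w := b _ - _; rewrite {2}/w innerBr innerDr innerZr -!bP.
  by rewrite innerDr innerZr subrr.
- have := cauchy_schwarz (A (b x)) x; rewrite bP inner_nrm cabs_real ?sqr_ge0//.
  have := nrm_op A (b x); have := nrm_ge0 x; have := nrm_ge0 (b x).
  have [b0|b0] := eqVneq (nrm (b x)) 0.
    by rewrite b0 mulr_ge0// ?op_nrm_ge0// nrm_ge0.
  move=> h1 h2 h3 h4.
  rewrite -(@ler_pM2l _ (nrm (b x))); last by rewrite lt_neqAle eq_sym b0.
  rewrite -expr2 (le_trans h4)// mulrA (mulrC _ (op_nrm A)).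
  by rewrite ler_wpM2r.
by exists B => y x; rewrite BE.
Qed.

Lemma adjointP (H K : hilbertType R) (A : bounded_op H K) x y :
  inner (A x) y = inner x (adjoint A y).
Proof.
have [B BP] := exists_adjoint A.
by rewrite /adjoint; case: xgetP => [C _ ->//|/(_ B)].
Qed.

Lemma adjointPr (H K : hilbertType R) (A : bounded_op H K) x y :
  inner x (A y) = inner (adjoint A x) y.
Proof. by rewrite innerC adjointP -innerC. Qed.

Lemma inner_ext (H : hilbertType R) (x y : H) :
  (forall z, inner z x = inner z y) -> x = y.
Proof.
move=> h; apply/eqP; rewrite -subr_eq0; apply/eqP/inner_self0.
by rewrite innerBr h subrr.
Qed.

Lemma op_ext (H K : hilbertType R) (A B : bounded_op H K) :
  (forall x, A x = B x) -> A = B.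
Proof. by move=> h; apply: val_inj; exact/funext. Qed.

Lemma adjoint_uniq (H K : hilbertType R) (A : bounded_op H K) (B : bounded_op K H) :
  (forall x y, inner (A x) y = inner x (B y)) -> adjoint A = B.
Proof. by move=> h; apply: op_ext => y; apply: inner_ext => z; rewrite -h adjointP. Qed.

Lemma adjointK (H K : hilbertType R) (A : bounded_op H K) : adjoint (adjoint A) = A.
Proof. by apply: adjoint_uniq => x y; rewrite adjointPr. Qed.

Lemma opB (H K : hilbertType R) (A : bounded_op H K) x y : A (x - y) = A x - A y.
Proof. exact: linearB. Qed.
Lemma opD (H K : hilbertType R) (A : bounded_op H K) x y : A (x + y) = A x + A y.
Proof. exact: linearD. Qed.
Lemma opZ (H K : hilbertType R) (A : bounded_op H K) (a : R[i]) x : A (a *: x) = a *: A x.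
Proof. exact: linearZ. Qed.
Lemma op0 (H K : hilbertType R) (A : bounded_op H K) : A 0 = 0.
Proof. exact: linear0. Qed.
Lemma opP (H K : hilbertType R) (A : bounded_op H K) (a : R[i]) x y :
  A (a *: x + y) = a *: A x + A y.
Proof. exact: linearP. Qed.

Lemma comp_opE (H K L : hilbertType R) (B : bounded_op K L) (A : bounded_op H K) x :
  comp_op B A x = B (A x).
Proof. by []. Qed.

End operators.

(** * Cardinals of sets *)

Section cardinals.

Lemma card_le_inj (T U : Type) (A : set T) (B : set U) (f : T -> U) :
  (forall x, A x -> B (f x)) ->
  (forall x y, A x -> A y -> f x = f y -> x = y) -> A #<= B.
Proof.
move=> fAB finj.
have h : f @` A #= A by apply: inj_card_eq => x y; rewrite !inE; exact: finj.
have h1 : A #<= f @` A by rewrite (card_le_eqr h) card_lexx.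
apply: card_le_trans h1 (subset_card_le _) => _ [x Ax <-]; exact: fAB.
Qed.

Lemma card_le_rel (T : Type) (U : pointedType) (A : set T) (B : set U) (r : T -> U -> Prop) :
  (forall x, A x -> exists2 y, B y & r x y) ->
  (forall x x' y, A x -> A x' -> r x y -> r x' y -> x = x') -> A #<= B.
Proof.
move=> ex inj.
have /choice[f fP] (x : T) : exists y, A x -> B y /\ r x y.
  have [/ex[y By rxy]|nA] := pselect (A x); first by exists y.
  by exists point.
apply: (card_le_inj (f := f)) => [x /fP[]//|x y Ax Ay e].
by apply: (inj x y (f x)) => //; [have [] := fP _ Ax|rewrite e; have [] := fP _ Ay].
Qed.

Lemma inj_of_card_le (T : Type) (U : pointedType) (A : set T) (B : set U) : A #<= B ->
  exists2 f : T -> U, (forall x, A x -> B (f x)) &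
    (forall x y, A x -> A y -> f x = f y -> x = y).
Proof.
move=> /pcard_leP[f]; exists f => [x Ax|x y Ax Ay].
  exact: funS.
by apply: inj; rewrite inE.
Qed.

(** Take, by Zorn's lemma, a maximal set [S] of choice functions for the family
    [C] any two of which differ at every member of [C]. By maximality the values
    of [S] exhaust some member [D0]; then a point of [D0] determines an element of
    [S], whose value at [D'] is an injection of [D0] into [D']. *)
Lemma card_min_exists (T : pointedType) (C : set (set T)) : C !=set0 ->
  exists D, C D /\ forall D', C D' -> D #<= D'.
Proof.
move=> [D1 CD1].
pose P (S : set (set T -> T)) :=
  (forall p D, S p -> C D -> D (p D)) /\
  (forall p q D, S p -> S q -> C D -> p D = q D -> p = q).
have [F FP totF|S [[SD Sinj] Smax]] := @Zorn_bigcup _ P.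
  split=> [p D [S FS Sp] CD|p q D [S FS Sp] [S' FS' Sq] CD].
    by have [h _] := FP _ FS; exact: (h p D).
  have [SS'|S'S] := totF _ _ FS FS'.
    by have [_ h] := FP _ FS'; apply: (h _ _ D) => //; exact: SS'.
  by have [_ h] := FP _ FS; apply: (h _ _ D) => //; exact: S'S.
have [D0 CD0 D0S] : exists2 D, C D & forall d, D d -> exists2 p, S p & p D = d.
  apply: contrapT => h.
  have /choice[f fP] (D : set T) : exists d, C D -> D d /\ forall p, S p -> p D <> d.
    have [CD|nCD] := pselect (C D); last by exists point.
    apply: contrapT => h2; apply: h; exists D => // d Dd.
    apply: contrapT => h3; apply: h2; exists d => _; split=> // p Sp pD.
    by apply: h3; exists p.
  have Sf : ~ S f by move=> Sf; have [_ /(_ f Sf)] := fP _ CD1.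
  apply: (Smax (S `|` [set f])).
    by split=> [p Sp|/(_ f (or_intror erefl))//]; left.
  split=> [p D [Sp|->] CD|p q D [Sp|->] [Sq|->] CD //].
  - exact: (SD p D).
  - by have [] := fP _ CD.
  - exact: Sinj CD.
  - by have [_ h'] := fP _ CD => /h'; case.
  - by have [_ h'] := fP _ CD => /esym/h'; case.
exists D0; split=> // D' CD'.
apply: (card_le_rel (r := fun d y => exists2 p, S p & p D0 = d /\ p D' = y)).
  by move=> d /D0S[p Sp pd]; exists (p D'); [exact: (SD p D')|exists p].
move=> x x' y _ _ [p Sp [<- py]] [q Sq [<- qy]].
by rewrite (Sinj _ _ D' Sp Sq CD')// py.
Qed.

(** Take, by Zorn's lemma, a maximal family [S] of injective sequences in [F] with
    pairwise disjoint ranges. Only finitely many points of [F] are left over, so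
    [F] embeds into [S * nat]: the points on the sequences get even codes and the
    remaining ones odd codes on a fixed sequence [c0]. Hence [F * nat] embeds into
    [S * nat], which embeds into [F]. *)
Lemma infinite_times_nat (T : pointedType) (F : set T) : infinite_set F ->
  F `*` [set: nat] #<= F.
Proof.
move=> Finf.
pose P (S : set (nat -> T)) :=
  (forall c, S c -> injective c /\ forall n, F (c n)) /\
  (forall c c' n m, S c -> S c' -> c n = c' m -> c = c').
have [G GP totG|S [[SF Sdisj] Smax]] := @Zorn_bigcup _ P.
  split=> [c [S GS Sc]|c c' n m [S GS Sc] [S' GS' Sc']].
    by have [h _] := GP _ GS; exact: h.
  have [SS'|S'S] := totG _ _ GS GS'.
    by have [_ h] := GP _ GS'; apply: h => //; exact: SS'.
  by have [_ h] := GP _ GS; apply: h => //; exact: S'S.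
pose Rem := F `\` [set x | exists c n, S c /\ c n = x].
have Rfin : finite_set Rem.
  apply: contrapT => /infiniteP/inj_of_card_le[c cR cinj].
  have Sc : ~ S c.
    by move=> Sc; have [_] := cR 0%N I; apply; exists c, 0%N.
  apply: (Smax (S `|` [set c])).
    by split=> [p Sp|/(_ c (or_intror erefl))//]; left.
  split=> [d [/SF//|->]|d d' n m [Sd|->] [Sd'|->] //].
  - by split=> [n m|n]; [exact: cinj|have [] := cR n I].
  - exact: Sdisj.
  - by move=> e; have [_] := cR m I; case; exists d, n.
  - by move=> e; have [_] := cR n I; case; exists d', m.
have [c0 Sc0] : exists c, S c.
  apply: contrapT => nS; apply: Finf; apply: sub_finite_set Rfin => x Fx.
  by split=> // -[c [_ [Sc _]]]; apply: nS; exists c.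
have /countable_injP[k] := finite_set_countable Rfin.
move=> kinj.
pose g x (ci : (nat -> T) * nat) := S ci.1 /\
  ((ci.1 (ci.2)./2 = x /\ ~~ odd ci.2) \/ [/\ Rem x, ci.1 = c0, odd ci.2 & ci.2./2 = k x]).
have gex x : F x -> exists ci, g x ci.
  move=> Fx; have [Rx|nRx] := pselect (Rem x).
    exists (c0, (k x).*2.+1); split=> //; right; split=> //=.
      by rewrite odd_double.
    by rewrite uphalf_double.
  have [c [n [Sc <-]]] : exists c n, S c /\ c n = x.
    by apply: contrapT => h; apply: nRx.
  by exists (c, n.*2); split=> //; left; rewrite /= odd_double doubleK.
have ginj x x' ci : g x ci -> g x' ci -> x = x'.
  case: ci => c i [/= Sc [[xE oi]|[Rx cE oi ki]]] [_ /=[[x'E oi']|[Rx' cE' oi' ki']]].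
  - by rewrite -xE.
  - by rewrite oi' in oi.
  - by rewrite oi in oi'.
  - by apply: kinj; rewrite ?inE// -ki.
apply: (card_le_rel (r := fun (xm : T * nat) (y : T) =>
  exists ci, g xm.1 ci /\ y = ci.1 (choice.pickle (ci.2, xm.2)))).
  move=> [x m] [/= Fx _]; have [ci gi] := gex x Fx.
  exists (ci.1 (choice.pickle (ci.2, m))); last by exists ci.
  by have [Sc _] := gi; have [_] := SF _ Sc; apply.
move=> [x m] [x' m'] y _ _ /= [[c i] [gx ->]] [[c' i'] [gx' /=]] e.
have [[/= Sc _] [/= Sc' _]] := (gx, gx').
have cc' : c = c' := Sdisj _ _ _ _ Sc Sc' e.
subst c'; have [cinj _] := SF _ Sc.
have /(pcan_inj (@choice.pickleK _)) [ii' mm'] := cinj _ _ e.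
by subst; rewrite (ginj _ _ _ gx gx').
Qed.

End cardinals.

(** * Orthonormal bases and the comparison of dimensions *)

Section bases.
Variables (R : realType) (H : hilbertType R).
Implicit Types (x y z v : H) (B V W : set H).

Lemma linear_span_linear B : linear_subspace (linear_span B).
Proof.
split=> [V [lV _]|a x y Bx By V VB]; first exact: lsub0.
by have [lV _] := VB; apply: lsubZD => //; [exact: Bx|exact: By].
Qed.

Lemma sub_linear_span B : B `<=` linear_span B.
Proof. by move=> x Bx V [_]; apply. Qed.

Lemma linear_span_min B V : linear_subspace V -> B `<=` V -> linear_span B `<=` V.
Proof. by move=> lV BV x; apply. Qed.

Lemma closed_span_min B V : closed_subspace V -> B `<=` V ->
  closure (linear_span B) `<=` V.
Proof.
move=> [lV cV] BV; apply: subset_trans cV; apply: closure_subset.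
exact: linear_span_min.
Qed.

Lemma orthonormal_neq0 B e : orthonormal_set B -> B e -> e != 0.
Proof.
move=> oB Be; apply/eqP => e0; have := oB e e Be Be.
by rewrite e0 inner0l eqxx => /esym/eqP; rewrite oner_eq0.
Qed.

Lemma orthonormal_nrm B e : orthonormal_set B -> B e -> nrm e = 1.
Proof.
move=> oB Be; have := oB e e Be Be; rewrite inner_nrm eqxx => /complexI h.
by apply/eqP; rewrite -(@eqrXn2 _ 2)// ?nrm_ge0// h expr1n.
Qed.

(** A maximal orthonormal subset of [V] (Zorn) spans [V]: otherwise the normalized
    component of some vector of [V] orthogonal to the span could be added. *)
Lemma exists_orthonormal_basis V : closed_subspace V ->
  exists B, orthonormal_basis V B.
Proof.
move=> cV; have lV := cV.1.
pose P B := orthonormal_set B /\ B `<=` V.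
have [F FP totF|B [[oB BV] Bmax]] := @Zorn_bigcup _ P.
  split=> [x y [S FS Sx] [S' FS' Sy]|x [S /FP[_ SV] /SV//]].
  have [SS'|S'S] := totF _ _ FS FS'.
    by have [h _] := FP _ FS'; apply: h => //; exact: SS'.
  by have [h _] := FP _ FS; apply: h => //; exact: S'S.
exists B; split=> //; apply/seteqP; split; first exact: closed_span_min.
have cS := closure_closed_subspace (linear_span_linear B).
set S := closure _ in cS *.
have BS : B `<=` S by move=> x Bx; apply: subset_closure; exact: sub_linear_span.
have SV : S `<=` V by exact: closed_span_min.
move=> v Vv; apply: contrapT => nSv.
pose w := v - proj S v.
have w0 : w != 0.
  by apply/eqP => /eqP; rewrite subr_eq0 => /eqP h; apply: nSv; rewrite h; exact: proj_in.
have nw := nrm_gt0 w0.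
pose e := (nrm w)^-1%:C *: w.
have ne : inner e e = 1.
  rewrite inner_nrm nrmZ cabs_real ?invr_ge0 ?nrm_ge0// mulVf ?gt_eqF//.
  by rewrite expr1n.
have eB x : B x -> inner e x = 0.
  move=> /BS Sx; rewrite innerZl.
  by move/perpP : (proj_perp v cS) => ->//; rewrite mulr0.
have nBe : ~ B e by move=> /eB; rewrite ne => /eqP; rewrite oner_eq0.
apply: (Bmax (B `|` [set e])).
  by split=> [x Bx|/(_ e (or_intror erefl))//]; left.
split=> [x y [Bx|->] [By|->]|x [/BV//|->]].
- exact: oB.
- by rewrite (inner_sym0 (eB _ Bx)); case: eqP => // xe; rewrite xe in Bx.
- by rewrite (eB _ By); case: eqP => // xe; rewrite -xe in By.
- by rewrite ne eqxx.
- apply: lsubZ => //; apply: lsubB => //; apply: SV; exact: proj_in.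
Qed.

Lemma hilbert_dimP V : closed_subspace V -> orthonormal_basis V (hilbert_dim V).
Proof.
move=> /exists_orthonormal_basis[B BV].
by rewrite /hilbert_dim; case: xgetP => // /(_ B).
Qed.

Lemma basis_sub V B : orthonormal_basis V B -> B `<=` V.
Proof. by move=> [_ <-] x Bx; apply: subset_closure; exact: sub_linear_span. Qed.

Lemma basis_total V B x v : orthonormal_basis V B -> V v -> inner x v <> 0 ->
  exists2 f, B f & inner x f <> 0.
Proof.
move=> [_ BV] Vv xv; apply: contrapT => h; apply: xv.
have /perpP -> // : perp V x.
apply/perpP => u; rewrite -BV => Bu.
apply: inner_sym0.
suff : perp [set x] u by move/perpP; apply.
apply: closed_span_min Bu; first exact: perp_closed.
move=> f Bf; apply/perpP => _ ->; apply: inner_sym0; apply: contrapT => xf.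
by apply: h; exists f.
Qed.

Lemma bessel_size B (s : seq H) g (r : R) : orthonormal_set B -> uniq s ->
  (forall e, e \in s -> B e) -> 0 <= r -> (forall e, e \in s -> r <= cabs (inner g e)) ->
  (size s)%:R * r ^+ 2 <= nrm g ^+ 2.
Proof.
move=> oB; elim: s g => [|e s ih] g /=; first by move=> *; rewrite mul0r sqr_ge0.
move=> /andP[es us] sB r0 rs.
have Be : B e by apply: sB; rewrite mem_head.
pose g' := g - inner g e *: e.
have g'e : inner g' e = 0.
  by rewrite innerBl innerZl (oB e e)// eqxx mulr1 subrr.
have ng : nrm g ^+ 2 = nrm g' ^+ 2 + cabs (inner g e) ^+ 2.
  rewrite -{1}(subrK (inner g e *: e) g) pythagoras -/g'; last first.
    by rewrite innerZr g'e mulr0.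
  by rewrite nrmZ (orthonormal_nrm oB Be) mulr1.
have h : (size s)%:R * r ^+ 2 <= nrm g' ^+ 2.
  apply: ih => // f fs; first by apply: sB; rewrite inE fs orbT.
  rewrite innerBl innerZl (oB e f)//; last by apply: sB; rewrite inE fs orbT.
  have /negPf -> : e != f by apply: contraNneq es => ->.
  by rewrite mulr0 subr0; apply: rs; rewrite inE fs orbT.
have re : r ^+ 2 <= cabs (inner g e) ^+ 2.
  by rewrite lerXn2r ?nnegrE ?cabs_ge0//; apply: rs; rewrite mem_head.
by rewrite ng -natr1 mulrDl mul1r lerD.
Qed.

(** By Bessel's inequality only finitely many members of [B] have an inner product
    with [g] that exceeds a given positive number. *)
Lemma bessel_countable B g : orthonormal_set B ->
  countable [set e | B e /\ inner e g <> 0].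
Proof.
move=> oB.
have -> : [set e | B e /\ inner e g <> 0] =
    \bigcup_(n in setT) [set e | B e /\ n.+1%:R^-1 <= cabs (inner g e)].
  apply/seteqP; split=> [e [Be eg]|e [n _ [Be ne]]]; last first.
    split=> // /inner_sym0 ge; move: ne; rewrite ge cabs0 leNgt.
    by rewrite invr_gt0 ltr0n.
  have c0 : 0 < cabs (inner g e).
    rewrite lt_neqAle cabs_ge0 andbT eq_sym; apply/eqP => /cabs_eq0 ge.
    by apply: eg; exact: inner_sym0.
  have [N _ /(_ N (leqnn N))/= h] := near_infty_natSinv_lt (PosNum c0).
  by exists N => //; split=> //; exact: ltW.
apply: bigcup_countable => // n _; apply: finite_set_countable.
apply: contrapT => inf.
have [X XB sX] := infinite_set_fset (Num.bound (nrm g ^+ 2 * n.+1%:R ^+ 2)) inf.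
have := @bessel_size B X g n.+1%:R^-1 oB (fset_uniq X).
rewrite invr_ge0 ler0n => /(_ (fun e eX => (XB e eX).1) isT (fun e eX => (XB e eX).2)).
rewrite exprVn ler_pdivrMr ?exprn_gt0// leNgt => /negP; apply.
rewrite (lt_le_trans (archi_boundP _))// ?ler_nat//.
by rewrite mulr_ge0 ?sqr_ge0.
Qed.

End bases.

Section dim_le.
Variables (R : realType) (H K : hilbertType R).

Lemma finite_or_more (T : choiceType) (A : set T) (n : nat) : ~ (A #<= `I_n) ->
  exists s : seq T, [/\ uniq s, size s = n.+1 & forall x, x \in s -> A x].
Proof.
move=> An.
have [X [XA sX]] : exists X : {fset T}, [set` X] `<=` A /\ (n < #|` X|)%N.
  have [Af|Ai] := pselect (finite_set A); last first.
    by have [X XA nX] := infinite_set_fset n.+1 Ai; exists X.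
  exists (fset_set A); split; first by move=> x /=; rewrite in_fset_set// inE.
  rewrite ltnNge; apply/negP => le; apply: An.
  have /finite_setP[m Am] := Af.
  by rewrite (card_le_eql Am) card_le_II -(card_fset_set Am).
exists (take n.+1 X); split; first exact/take_uniq/fset_uniq.
  by rewrite size_takel.
by move=> x /mem_take xX; apply: XA.
Qed.

(** The basic comparison of dimensions. If [F] is infinite, each [e] in [E] is
    sent to some [f] with [inner (T e) f <> 0]; by Bessel's inequality applied to
    [adjoint T f] only countably many [e] share the same [f], so [E] embeds into
    [F * nat]. If [F] has [n] elements, then [n + 1] vectors of [E] would have a
    nonzero combination mapped by [T] to a vector orthogonal to [F]. *)
Lemma card_le_pairing (E : set H) (F : set K) (T : bounded_op H K) :
  orthonormal_set E ->
  (forall x, closure (linear_span E) x -> x != 0 -> exists2 f, F f & inner (T x) f <> 0) ->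
  E #<= F.
Proof.
move=> oE h.
have Esp e : E e -> closure (linear_span E) e.
  by move=> Ee; apply: subset_closure; exact: sub_linear_span.
have [Ff|Fi] := pselect (finite_set F); last first.
  apply: card_le_trans (infinite_times_nat Fi).
  have /choice[k kinj] (f : K) : exists k : H -> nat,
      {in [set e | E e /\ inner e (adjoint T f) <> 0] &, injective k}.
    by apply/countable_injP; exact: bessel_countable.
  apply: (card_le_rel (U := (K * nat)%type)
    (r := fun e fn => inner (T e) fn.1 <> 0 /\ fn.2 = k fn.1 e)).
    move=> e Ee; have [f Ff Tf] := h e (Esp _ Ee) (orthonormal_neq0 oE Ee).
    by exists (f, k f e).
  move=> e e' [f n] Ee Ee' /= [ef ->] [e'f kk].
  by apply: (kinj f) => //; rewrite inE; split=> //; rewrite -adjointP.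
apply: contrapT => nEF.
pose n := #|` fset_set F|%fset.
have Fn : F #= `I_n.
  by have /finite_setP[m Fm] := Ff; rewrite /n (card_fset_set Fm).
have nEn : ~ (E #<= `I_n) by rewrite -(card_le_eqr Fn).
have [s [us ss sE]] := finite_or_more nEn.
pose fs : seq K := fset_set F.
(* A left kernel vector of M exists because M has more rows than columns. *)
pose M : 'M[R[i]]_(n.+1, n) := \matrix_(i, j) inner (T s`_i) fs`_j.
have [a a0 aM] : exists2 a : 'rV[R[i]]_n.+1, a != 0 & a *m M = 0.
  have : kermx M != 0.
    rewrite -mxrank_eq0 mxrank_ker subn_eq0 -ltnNge.
    by rewrite (leq_ltn_trans (rank_leq_col M)).
  by move=> /rowV0Pn[a /sub_kermxP aM a0]; exists a.
pose x := \sum_(i < n.+1) a 0 i *: s`_i.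
have sin (i : 'I_n.+1) : E s`_i by apply: sE; rewrite mem_nth// ss.
have xsp : linear_span E x.
  have lsp := linear_span_linear E.
  apply: (@big_ind _ (linear_span E)) => [|u v|i _]; first exact: lsub0.
  - exact: lsubD.
  - by apply: (lsubZ (V := linear_span E)) => //; exact: sub_linear_span.
have xs (k : 'I_n.+1) : inner x s`_k = a 0 k.
  rewrite /x linear_sumlz/= (bigD1 k)//= big1 ?addr0 => [|i ik].
    by rewrite innerZl oE// eqxx mulr1.
  by rewrite innerZl oE// nth_uniq ?ss// (inj_eq val_inj) (negPf ik) mulr0.
have x0 : x != 0.
  apply: contra_neq a0 => x0; apply/rowP => k.
  by rewrite -xs x0 inner0l mxE.
have [f Fxf] := h x (subset_closure xsp) x0; apply.
have fin : f \in fs by rewrite in_fset_set// inE.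
have fi : (index f fs < n)%N by rewrite index_mem.
have /rowP/(_ (Ordinal fi)) := aM; rewrite !mxE => <-.
rewrite /x linear_sum/= linear_sumlz; apply: eq_bigr => i _.
by rewrite mxE linearZ/= innerZl nth_index.
Qed.

(** [dim X <= dim Y] as soon as the pairing of [X] and [Y] induced by [T] has no
    kernel in [X]; with [T] the identity this says that no nonzero vector of [X] is
    orthogonal to [Y]. All the comparisons of dimensions below are of this form. *)
Lemma hilbert_dim_le (X : set H) (Y : set K) (T : bounded_op H K) :
  closed_subspace X -> closed_subspace Y ->
  (forall x, X x -> x != 0 -> exists2 y, Y y & inner (T x) y <> 0) ->
  hilbert_dim X #<= hilbert_dim Y.
Proof.
move=> cX cY h; have [oX sX] := hilbert_dimP cX.
apply: (card_le_pairing (T := T) oX) => x; rewrite sX => Xx x0.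
have [y Yy xy] := h x Xx x0.
exact: basis_total (hilbert_dimP cY) Yy xy.
Qed.

Lemma basis_card_le (X : set H) (Y : set K) (B : set H) (C : set K) (T : bounded_op H K) :
  orthonormal_basis X B -> orthonormal_basis Y C ->
  (forall x, X x -> x != 0 -> exists2 y, Y y & inner (T x) y <> 0) -> B #<= C.
Proof.
move=> [oB sB] BY h.
apply: (card_le_pairing (T := T) oB) => x; rewrite sB => Xx x0.
have [y Yy xy] := h x Xx x0.
exact: basis_total BY Yy xy.
Qed.

End dim_le.

(** * The indices as least codimensions *)

Section complete.
Variables (R : realType) (H : hilbertType R).
Implicit Types (x y z v : H) (B V W E : set H).

(** Together with the converse below: the complete subspaces in the definition of
    [IC] are the closed ones. *)
Lemma closed_complete V : closed_subspace V -> complete_set V.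
Proof.
move=> [_ cV] F FF FV cF.
have cvF : cvg F by exact: cauchy_cvg.
exists (lim F) => //; apply: cV => B /cvF FB.
have FB' : F B := FB.
have FF' : Filter F by case: FF.
by have /filter_ex[y VBy] : F (V `&` B); [exact: filterI|exists y].
Qed.

Lemma complete_closed V : complete_set V -> closure V `<=` V.
Proof.
move=> cV x cx.
have PF : ProperFilter (within V (nbhs x)) by exact: within_nbhs_proper.
have cvF : within V (nbhs x) --> x by exact: cvg_within.
have [|| y Vy Fy] := cV _ PF.
- exact: withinT.
- by apply: cvg_cauchy; apply/cvg_ex; exists x.
- suff <- : y = x by [].
  exact: (cvg_unique _ Fy cvF).
Qed.

Lemma basis_card_eq V (B C : set H) : orthonormal_basis V B -> orthonormal_basis V C ->
  B #= C.
Proof.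
move=> VB VC.
have h x : V x -> x != 0 -> exists2 y, V y & inner (id_op H x) y <> 0.
  by move=> Vx /eqP x0; exists x => // /inner_self0.
by apply/card_eqPle; split;
  [exact: (basis_card_le VB VC h)|exact: (basis_card_le VC VB h)].
Qed.

Lemma basis_add (E V B1 B2 : set H) : closed_subspace E -> closed_subspace V -> V `<=` E ->
  orthonormal_basis (perp E) B1 -> orthonormal_basis (ominus E V) B2 ->
  orthonormal_basis (perp V) (B1 `|` B2).
Proof.
move=> cE cV VE b1 b2.
have cross x y : B1 x -> B2 y -> inner x y = 0.
  by move=> /(basis_sub b1)/perpP + /(basis_sub b2)[Ey _]; apply.
have ncross x y : B1 x -> B2 y -> x != y.
  move=> B1x B2y; apply/eqP => xy; have := cross _ _ B1x B2y.
  rewrite xy => /inner_self0 y0.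
  by have := orthonormal_neq0 b2.1 B2y; rewrite y0 eqxx.
split.
  move=> x y [Bx|Bx] [By|By].
  - by rewrite b1.1.
  - by rewrite cross// (negPf (ncross _ _ Bx By)).
  - by rewrite (inner_sym0 (cross _ _ By Bx)) eq_sym (negPf (ncross _ _ By Bx)).
  - by rewrite b2.1.
have cS := closure_closed_subspace (linear_span_linear (B1 `|` B2)).
apply/seteqP; split.
  apply: closed_span_min; first exact: perp_closed.
  move=> x [/(basis_sub b1)/perpP h|/(basis_sub b2)[_ h]]; apply/perpP => v Vv.
    by apply: h; exact: VE.
  exact: h.
move=> x /perpP Vx; rewrite -(subrK (proj E x) x).
apply: (lsubD cS.1).
  have : perp E (x - proj E x) by exact: proj_perp.
  rewrite -b1.2; apply: closure_subset; apply: linear_span_min.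
    exact: linear_span_linear.
  by move=> y By; apply: sub_linear_span; left.
have : ominus E V (proj E x).
  split=> [|v Vv]; first exact: proj_in.
  have := Vx _ Vv; rewrite -{1}(subrK (proj E x) x) innerDl.
  by move/perpP : (proj_perp x cE) => ->; [rewrite add0r|exact: VE].
rewrite -b2.2; apply: closure_subset; apply: linear_span_min.
  exact: linear_span_linear.
by move=> y By; apply: sub_linear_span; right.
Qed.

Lemma card_sum_union (B1 B2 : set H) : (forall x, B1 x -> B2 x -> False) ->
  Defs.card_sum B1 B2 #= B1 `|` B2.
Proof.
move=> dis; pose f (x : H + H) := match x with inl x => x | inr x => x end.
have -> : B1 `|` B2 = f @` Defs.card_sum B1 B2.
  apply/seteqP; split=> [x [Bx|Bx]|_ [_ [[x Bx <-]|[x Bx <-]] <-]].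
  - by exists (inl x) => //; left; exists x.
  - by exists (inr x) => //; right; exists x.
  - by left.
  - by right.
rewrite card_eq_sym; apply: inj_card_eq => x y; rewrite !inE.
move=> [[u Bu <-]|[u Bu <-]] [[w Bw <-]|[w Bw <-]] /= uw; rewrite ?uw//.
  by exfalso; apply: (dis u) => //; rewrite uw.
by exfalso; apply: (dis w) => //; rewrite -uw.
Qed.

(** The orthogonal complement of [V] is the orthogonal sum of that of [E] and of
    [ominus E V], so the cardinal sum in the definition of the indices is again the
    dimension of a single subspace. *)
Lemma codim_add (E V : set H) : closed_subspace E -> closed_subspace V -> V `<=` E ->
  Defs.card_sum (hilbert_dim (perp E)) (hilbert_dim (ominus E V)) #= hilbert_dim (perp V).
Proof.
move=> cE cV VE.
have b1 := hilbert_dimP (perp_closed E).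
have b2 := hilbert_dimP (ominus_closed V cE).
apply: card_eq_trans (card_sum_union _) _.
  move=> x B1x B2x; have /eqP[] := orthonormal_neq0 b1.1 B1x.
  have [Ex _] := basis_sub b2 B2x; apply: perp_self0 Ex _.
  exact: basis_sub b1 _ B1x.
exact: basis_card_eq (basis_add cE cV VE b1 b2) (hilbert_dimP (perp_closed V)).
Qed.

End complete.

Section cardsum.
Lemma card_sum_le (T U : Type) (T' U' : pointedType) (A : set T) (A' : set T')
    (B : set U) (B' : set U') :
  A #<= A' -> B #<= B' -> Defs.card_sum A B #<= Defs.card_sum A' B'.
Proof.
move=> /inj_of_card_le[f fA finj] /inj_of_card_le[g gB ginj].
apply: (card_le_inj (f := fun x => match x with inl x => inl (f x) | inr y => inr (g y) end)).
  by move=> _ [[x Ax <-]|[y By <-]]; [left; exists (f x) => //; exact: fA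
                                    |right; exists (g y) => //; exact: gB].
move=> _ _ [[x Ax <-]|[x Ax <-]] [[y Ay <-]|[y Ay <-]]// [e].
  by rewrite (finj x y).
by rewrite (ginj x y).
Qed.

Lemma card_sum_eq (T U T' U' : pointedType) (A : set T) (A' : set T')
    (B : set U) (B' : set U') :
  A #= A' -> B #= B' -> Defs.card_sum A B #= Defs.card_sum A' B'.
Proof.
move=> /card_eqPle[AA' A'A] /card_eqPle[BB' B'B].
by apply/card_eqPle; split; exact: card_sum_le.
Qed.
End cardsum.

Section iota.
Variables (R : realType) (H K : hilbertType R).
Implicit Types (V W E : set K).

Lemma range_linear (A : bounded_op H K) : linear_subspace (range A).
Proof.
split=> [|a _ _ [x _ <-] [y _ <-]]; first by exists 0 => //; rewrite linear0.
by exists (a *: x + y) => //; rewrite linearP.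
Qed.

Lemma IC_attained E : linear_subspace E -> exists V,
  [/\ closed_subspace V, V `<=` E & IC E = hilbert_dim (ominus (closure E) V)].
Proof.
move=> lE.
have c0 : closed_subspace [set (0 : K)].
  split=> [|x /closure_nrm cx].
    by split=> [//|a x y -> ->]; rewrite scaler0 addr0.
  apply: nrm_eq0; apply/eqP; rewrite eq_le nrm_ge0 andbT; apply/ler_addgt0Pr => e e0.
  by have [_ ->] := cx e e0; rewrite subr0 add0r => /ltW.
have [|D [[V [lV VE kV] DV] Dmin]] := @card_min_exists _ (IC_codims E).
  exists (hilbert_dim (ominus (closure E) [set 0])), [set 0] => //.
  by split; [exact: c0.1|move=> _ ->; exact: lsub0|exact: closed_complete].
rewrite /IC; case: xgetP => [D' -> [[V' [lV' V'E kV'] DV'] _]|/(_ D)]; last first.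
  by case; split=> //; exists V.
by exists V'; split=> //; split=> //; exact: complete_closed.
Qed.

Lemma IC_le E V : linear_subspace E -> closed_subspace V -> V `<=` E ->
  IC E #<= hilbert_dim (ominus (closure E) V).
Proof.
move=> lE cV VE.
have [|D [[V1 [lV1 V1E kV1] DV1] Dmin]] := @card_min_exists _ (IC_codims E).
  exists (hilbert_dim (ominus (closure E) V)), V => //.
  by split => //; [exact: cV.1|exact: closed_complete].
rewrite /IC; case: xgetP => [D' -> [_ h]|/(_ D)]; last first.
  by case; split=> //; exists V1.
by apply: h; exists V => //; split => //; [exact: cV.1|exact: closed_complete].
Qed.

(** Together with [iota_f_le]: [iota_f A] is the least codimension of a closed
    subspace contained in the range of [A]. This is the only description of
    [iota_f] used in the sequel. *)
Lemma iota_f_attained (A : bounded_op H K) : exists V,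
  [/\ closed_subspace V, V `<=` range A & iota_f A #= hilbert_dim (perp V)].
Proof.
have [V [cV VA e]] := IC_attained (range_linear A).
exists V; split=> //; rewrite /iota_f e; apply: codim_add => //.
  exact/closure_closed_subspace/range_linear.
by apply: subset_trans VA _; exact: subset_closure.
Qed.

Lemma iota_f_le (A : bounded_op H K) V : closed_subspace V -> V `<=` range A ->
  iota_f A #<= hilbert_dim (perp V).
Proof.
move=> cV VA.
have cE := closure_closed_subspace (range_linear A).
have VE : V `<=` closure (range A) by apply: subset_trans VA _; exact: subset_closure.
rewrite -(card_le_eqr (codim_add cE cV VE)).
by apply: card_sum_le => //; exact: IC_le (range_linear A) cV VA.
Qed.

Lemma preimage_closed_subspace (A : bounded_op H K) V : closed_subspace V ->
  closed_subspace [set x | V (A x)].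
Proof.
move=> [lV cV]; split=> [|x /closure_nrm cx].
  split=> [|a x y Vx Vy]; rewrite /= ?linear0 ?linearP; first exact: lsub0.
  exact: lsubZD.
apply/cV/closure_nrm => e e0.
have M0 := op_nrm_ge0 A.
have [|y Vy] := cx (e / (op_nrm A + 1)); first by rewrite divr_gt0//; lra.
rewrite ltr_pdivlMr; last by lra.
move=> xy; exists (A y) => //; rewrite -linearB.
have := nrm_op A (x - y); have := nrm_ge0 (x - y); nra.
Qed.

Lemma setI_closed_subspace (V W : set K) : closed_subspace V -> closed_subspace W ->
  closed_subspace (V `&` W).
Proof.
move=> [lV cV] [lW cW]; split=> [|x cx].
  split=> [|a x y [Vx Wx] [Vy Wy]]; first by split; exact: lsub0.
  by split; exact: lsubZD.
by split; [apply: cV|apply: cW]; apply: closure_subset cx => y [].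
Qed.

End iota.

(** * Bounded inverses on closed parts of the range *)

Section bounded_inverse.
Variables (R : realType).

Definition third : R := 3^-1.

Lemma third_lt (n : nat) : third ^+ n * n.+1%:R <= 1.
Proof.
rewrite /third exprVn mulrC ler_pdivrMr ?exprn_gt0// mul1r -natrX ler_nat.
exact: ltn_expl.
Qed.

Lemma cabs_max (a b : R[i]) : cabs b <= cabs (a + b) \/ cabs b <= cabs (a - b).
Proof.
have := cabsD (a + b) (- (a - b)).
have -> : a + b - (a - b) = 2%:R%:C * b by rewrite rmorph_nat; ring.
rewrite cabsN cabsM cabs_real ?ler0n// => h.
by have [|] := leP (cabs b) (cabs (a + b)) => h'; [left|right; lra].
Qed.

(** The second bound is the tail of the geometric series of ratio [third]. *)
Lemma geometric_cauchy (H : hilbertType R) (u : nat -> H) :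
  (forall n, nrm (u n.+1 - u n) <= third ^+ n) ->
  norm_cauchy u /\ (forall n j, nrm (u (n + j)%N - u n) <= 3 / 2 * third ^+ n).
Proof.
move=> h.
have t0 n : 0 < third ^+ n by rewrite exprn_gt0// invr_gt0.
have h1 n j : nrm (u (n + j)%N - u n) <= 3 / 2 * third ^+ n * (1 - third ^+ j).
  elim: j => [|j ih]; first by rewrite addn0 !subrr nrm0 mulr0.
  rewrite addnS (le_trans (nrm_tri (u (n + j)%N) _ _))//.
  have := h (n + j)%N; rewrite exprD exprS.
  move: ih (t0 n) (t0 j); set a := third ^+ n; set b := third ^+ j.
  by rewrite /third; move=> ? ? ?; lra.
have h2 n j : nrm (u (n + j)%N - u n) <= 3 / 2 * third ^+ n.
  by have := h1 n j; have := mulr_gt0 (t0 n) (t0 j); lra.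
split=> // e e0.
(* Two terms beyond the Nth are each within 3/2 * third ^ N of it. *)
have [N Ne] : exists N, 3 * third ^+ N < e.
  exists (Num.bound (3 / e)).
  have := third_lt (Num.bound (3 / e)).
  have : 3 / e < (Num.bound (3 / e)).+1%:R.
    by rewrite (lt_trans (archi_boundP _)) ?ltr_nat// divr_ge0// ltW.
  rewrite ltr_pdivrMr//; have := t0 (Num.bound (3 / e)).
  set a := _ ^+ _; set b := (Num.bound (3 / e)).+1%:R => a0 h3 h4.
  have : a * 3 < a * (b * e) by rewrite ltr_pM2l.
  have : a * b * e <= 1 * e by rewrite ler_pM2r.
  lra.
exists N => m n /subnKC <- /subnKC <-.
have := h2 N (m - N)%N; have := h2 N (n - N)%N.
have := nrm_tri (u N) (u (N + (m - N))%N) (u (N + (n - N))%N).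
by rewrite (nrm_subC (u N)); lra.
Qed.

(** The gliding hump. If the projections [p n] of elements of [S] grow faster than
    [2 * n.+1 / third ^ n], then a series with terms [+- third ^ n * p n / |p n|]
    has a sum [l] in [V]. Its [n]th sign is chosen so that the partial sum pairs with
    [p n] at least as strongly as the [n]th term does, and the later terms cannot
    undo more than half of this; so the pairing of [l] with [p n] is at least
    [n.+1]. *)
Lemma uniform_boundedness (K : hilbertType R) (V S : set K) : closed_subspace V ->
  (forall v, V v -> exists M, forall k, S k -> cabs (inner v k) <= M) ->
  exists2 C : R, 0 < C & forall k, S k -> nrm (proj V k) <= C.
Proof.
move=> cV h; apply: contrapT => nC.
have lV := cV.1.
have t0 n : 0 < third ^+ n by rewrite exprn_gt0// invr_gt0.
have /choice[k kP] (n : nat) : exists k, S k /\ 2 * n.+1%:R / third ^+ n < nrm (proj V k).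
  apply: contrapT => h2; apply: nC; exists (2 * n.+1%:R / third ^+ n).
    by rewrite divr_gt0// mulr_gt0// ltr0n.
  move=> k Sk; rewrite leNgt; apply/negP => h3; apply: h2; by exists k.
pose p n := proj V (k n).
have p0 n : 0 < nrm (p n).
  by apply: lt_trans (kP n).2; rewrite divr_gt0// mulr_gt0// ltr0n.
have Vp n : V (p n) by exact: proj_in.
have pk n v : V v -> inner v (k n) = inner v (p n).
  move=> Vv; rewrite -{1}(subrK (p n) (k n)) innerDr.
  by rewrite [X in X + _]inner_sym0 ?add0r//; move/perpP: (proj_perp (k n) cV); apply.
have step n x : exists y, V x -> [/\ V y, nrm (y - x) <= third ^+ n &
    third ^+ n * nrm (p n) <= cabs (inner y (p n))].
  pose z := (third ^+ n / nrm (p n))%:C *: p n.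
  have Vz : V z by exact: lsubZ.
  have nz : nrm z = third ^+ n.
    rewrite nrmZ cabs_real; last by rewrite divr_ge0// ?nrm_ge0// ltW.
    by rewrite mulfVK// gt_eqF.
  have zp : cabs (inner z (p n)) = third ^+ n * nrm (p n).
    rewrite innerZl inner_nrm -rmorphM/= cabs_real; last first.
      by rewrite mulr_ge0 ?sqr_ge0// divr_ge0// ?nrm_ge0// ltW.
    by rewrite expr2 mulrA mulfVK// gt_eqF.
  have [hp|hm] := cabs_max (inner x (p n)) (inner z (p n)).
    exists (x + z) => Vx; split; first exact: lsubD.
      by rewrite addrAC subrr add0r nz.
    by rewrite innerDl -zp.
  exists (x - z) => Vx; split; first exact: lsubB.
    by rewrite addrAC subrr add0r nrmN nz.
  by rewrite innerBl -zp.
have /choice[f fP] : forall nx : nat * K, exists y, V nx.2 ->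
    [/\ V y, nrm (y - nx.2) <= third ^+ nx.1 &
    third ^+ nx.1 * nrm (p nx.1) <= cabs (inner y (p nx.1))].
  by move=> [n x]; exact: step.
pose x := fix x n := if n is n'.+1 then f (n', x n') else 0.
have Vx n : V (x n).
  elim: n => [|n ih] /=; first exact: lsub0.
  by have [] := fP (n, x n) ih.
have [cx hx] : norm_cauchy x /\ (forall n j, nrm (x (n + j)%N - x n) <= 3 / 2 * third ^+ n).
  by apply: geometric_cauchy => n; have [] := fP (n, x n) (Vx n).
have [l xl] := norm_cauchy_cvg cx.
have Vl : V l by apply: closed_subspace_lim cV Vx xl.
have lx n : nrm (l - x n) <= 3 / 2 * third ^+ n.
  apply: (@norm_cvg_nrm_le _ _ (fun m => x m - x n)).
    by apply: norm_cvgD => //; exact: norm_cvg_cst.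
  by exists n => m nm; rewrite -(subnKC nm).
have [M hM] := h l Vl.
have big n : n.+1%:R <= M.
  have [_ _ h1] := fP (n, x n) (Vx n).
  have h2 := hM _ (kP n).1; rewrite pk// in h2.
  have := lx n.+1; rewrite exprS => h3.
  have := cauchy_schwarz (x n.+1 - l) (p n); rewrite nrm_subC => h4.
  have := cabsD (inner (x n.+1 - l) (p n)) (inner l (p n)).
  rewrite innerBl subrK => h5.
  rewrite innerBl in h4.
  have := (kP n).2; rewrite ltr_pdivrMr// -/(p n) => h6.
  have h7 : nrm (l - x n.+1) * nrm (p n) <= third ^+ n / 2 * nrm (p n).
    rewrite ler_pM2r//; move: h3; rewrite /third; lra.
  move: h1 h5 h4 h2 h7 h6 => /=; set a := third ^+ n; lra.
have M0 : 0 <= M by rewrite (le_trans _ (big 0%N)).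
by have := big (Num.bound M); rewrite leNgt (lt_trans (archi_boundP M0))// ltr_nat.
Qed.

Variables (H K : hilbertType R).

Lemma perp_range_adjoint (A : bounded_op H K) :
  perp (range (adjoint A)) = [set x | A x = 0].
Proof.
apply/seteqP; split=> x.
  move=> /perpP h; apply: inner_self0; rewrite adjointP; apply: h.
  by exists (A x).
by move=> Ax; apply/perpP => _ [y _ <-]; rewrite -adjointP Ax inner0l.
Qed.

(** A form of the bounded inverse theorem. Take for [W] the preimage of [V] in the
    closure [X] of the range of [adjoint A], which is the orthogonal complement of
    the kernel of [A]. The vectors [k] with [nrm (adjoint A k) <= 1] are weakly bounded
    on [V], because [inner (A w) k = inner w (adjoint A k)]; hence they are bounded
    there, which bounds [inner w (adjoint A k)] by [C * nrm (A w) * nrm (adjoint A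
    k)]. As the vectors [adjoint A k] are dense in [X], this bounds [w]. *)
Lemma closed_image_section (A : bounded_op H K) (V : set K) : closed_subspace V ->
  V `<=` range A -> exists W (c : R), [/\ closed_subspace W, 0 < c,
    (forall w, W w -> c * nrm w <= nrm (A w)), W `<=` closure (range (adjoint A)) &
    A @` W = V].
Proof.
move=> cV VA.
pose X := closure (range (adjoint A)).
have cX : closed_subspace X by apply: closure_closed_subspace; exact: range_linear.
have pX : perp X = [set x | A x = 0] by rewrite perp_closure perp_range_adjoint.
pose W := X `&` [set x | V (A x)].
have cW : closed_subspace W.
  by apply: setI_closed_subspace => //; exact: preimage_closed_subspace.
have lift v : V v -> exists2 w, W w & A w = v.
  move=> Vv; have [x _ xv] := VA _ Vv.
  have e : A (proj X x) = v.
    have : perp X (x - proj X x) by exact: proj_perp.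
    rewrite pX => /= Ax0.
    by apply/eqP; rewrite -xv eq_sym -subr_eq0 -opB Ax0.
  exists (proj X x) => //; split; first exact: proj_in.
  by rewrite /= e.
pose S := [set k : K | nrm (adjoint A k) <= 1].
have [v Vv|C C0 hC] := @uniform_boundedness K V S cV.
  have [w Ww <-] := lift v Vv; exists (nrm w) => k Sk.
  rewrite adjointP (le_trans (cauchy_schwarz _ _))// ler_piMr// ?nrm_ge0//.
exists W, (C^-1); split=> //.
- by rewrite invr_gt0.
- move=> w [Xw Vw]; rewrite ler_pdivrMl//.
  have main k : cabs (inner w (adjoint A k)) <= C * nrm (A w) * nrm (adjoint A k).
    rewrite -adjointP.
    have [z|nz] := eqVneq (adjoint A k) 0.
      by rewrite adjointP z inner0r cabs0 nrm0 mulr0.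
    have n0 := nrm_gt0 nz.
    (* By homogeneity, normalize k so that it lies in S. *)
    pose k' := ((nrm (adjoint A k))^-1)%:C *: k.
    have Sk' : S k'.
      by rewrite /S/= linearZ nrmZ cabs_real ?invr_ge0 ?nrm_ge0// mulVf// gt_eqF.
    have e : inner (A w) k = (nrm (adjoint A k))%:C * inner (A w) (proj V k').
      have -> : inner (A w) (proj V k') = inner (A w) k'.
        rewrite -{2}(subrK (proj V k') k') innerDr.
        by rewrite [X in _ = X + _]inner_sym0 ?add0r//; move/perpP: (proj_perp k' cV); apply.
      rewrite innerZr conj_Creal ?complex_real// mulrA -rmorphM/=.
      by rewrite mulfV ?gt_eqF// mul1r.
    rewrite e cabsM cabs_real ?nrm_ge0// mulrC.
    apply: ler_pM => //; [exact: cabs_ge0|exact: nrm_ge0|].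
    rewrite (le_trans (cauchy_schwarz _ _))// mulrC.
    by rewrite ler_wpM2r ?nrm_ge0// hC.
  have [->|w0] := eqVneq w 0; first by rewrite nrm0 mulr_ge0 ?nrm_ge0// ltW.
  have nw := nrm_gt0 w0.
  apply/ler_addgt0Pr => e e0.
  have a0 : 0 <= C * nrm (A w) by rewrite mulr_ge0 ?nrm_ge0// ltW.
  (* Approximate w by some adjoint A k within d, chosen so that the error
     d * (nrm w + C * nrm (A w)) is below nrm w * e. *)
  pose d := nrm w * e / (nrm w + C * nrm (A w) + 1).
  have d0 : 0 < d by rewrite divr_gt0 ?mulr_gt0//; lra.
  have dE : d * (nrm w + C * nrm (A w) + 1) = nrm w * e by rewrite mulfVK// gt_eqF//; lra.
  move/closure_nrm : Xw => /(_ _ d0)[_ [k _ <-]] h1.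
  have h2 := main k.
  have h3 := cauchy_schwarz w (w - adjoint A k).
  have h4 := cabsD (inner w (w - adjoint A k)) (inner w (adjoint A k)).
  rewrite innerBr subrK inner_nrm cabs_real ?sqr_ge0// in h4.
  rewrite innerBr inner_nrm in h3.
  have h5 := nrm_ge_sub (adjoint A k) w; rewrite nrm_subC in h5.
  rewrite -(ler_pM2l nw).
  have h6 : nrm w * nrm (w - adjoint A k) <= nrm w * d by rewrite ler_pM2l// ltW.
  have h7 : C * nrm (A w) * nrm (adjoint A k) <= C * nrm (A w) * (nrm w + d).
    by rewrite ler_wpM2l//; lra.
  lra.
- by move=> x [].
- apply/seteqP; split=> [_ [w [_ Vw] <-]//|v /lift[w Ww <-]].
  by exists w.
Qed.

End bounded_inverse.

(** * Square roots of operators *)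

Section limits.
Variables (R : realType).

Lemma inner_cvg (H : hilbertType R) (u u' : nat -> H) x x' : norm_cvg u x -> norm_cvg u' x' ->
  forall e : R, 0 < e -> exists N, forall n, (N <= n)%N ->
    cabs (inner (u n) (u' n) - inner x x') < e.
Proof.
move=> ux ux' e e0.
pose C := nrm x + nrm x' + 1.
have C0 : 0 < C by rewrite /C; have := nrm_ge0 x; have := nrm_ge0 x'; lra.
have d0 : 0 < e / 2 / C by rewrite !divr_gt0.
have [N hN] := ux _ d0.
have [N' hN'] := ux' _ d0.
have [N1 hN1] := ux' 1 ltr01.
exists (maxn N (maxn N' N1)) => n; rewrite !geq_max => /and3P[/hN a /hN' b /hN1 c].
have -> : inner (u n) (u' n) - inner x x' = inner (u n - x) (u' n) + inner x (u' n - x').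
  by rewrite innerBl innerBr addrA subrK.
have := cabsD (inner (u n - x) (u' n)) (inner x (u' n - x')).
have := cauchy_schwarz (u n - x) (u' n); have := cauchy_schwarz x (u' n - x').
have := nrm_ge_sub (u' n) x'.
move: a b; rewrite !ltr_pdivlMr// /C.
have := nrm_ge0 (u n - x); have := nrm_ge0 (u' n - x'); have := nrm_ge0 (u' n).
have := nrm_ge0 x; have := nrm_ge0 x'.
nra.
Qed.

Lemma inner_lim_eq (H K : hilbertType R) (u u' : nat -> H) (v v' : nat -> K) x x' y y' :
  norm_cvg u x -> norm_cvg u' x' -> norm_cvg v y -> norm_cvg v' y' ->
  (forall n, inner (u n) (u' n) = inner (v n) (v' n)) -> inner x x' = inner y y'.
Proof.
move=> ux ux' vy vy' h; apply/eqP; rewrite -subr_eq0; apply/eqP/cabs_small0 => e e0.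
have [|N hN] := inner_cvg ux ux' (e := e / 2); first by lra.
have [|M hM] := inner_cvg vy vy' (e := e / 2); first by lra.
have := hN _ (leq_maxl N M); have := hM _ (leq_maxr N M); rewrite h.
set n := maxn N M; set z := inner (v n) _.
have := cabsD (inner x x' - z) (z - inner y y'); rewrite addrA subrK.
rewrite -(cabsN (inner x x' - z)) opprB; lra.
Qed.

End limits.

Section sqrt.
Variables (R : realType) (H : hilbertType R).

Definition symmetric_op (T : bounded_op H H) := forall x y, inner (T x) y = inner x (T y).

Definition one_half : R[i] := (2^-1 : R)%:C.

Lemma nrm_half (x : H) : nrm (one_half *: x) = nrm x / 2.
Proof. by rewrite nrmZ cabs_real ?invr_ge0 ?ler0n// mulrC. Qed.

Lemma half_double (x : H) : one_half *: x + one_half *: x = x.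
Proof.
rewrite -scalerDl -rmorphD/=.
have -> : 2^-1 + 2^-1 = 1 :> R by lra.
by rewrite scale1r.
Qed.

(** Picard iteration for [Y = (X + Y ^ 2) / 2], that is [(1 - Y) ^ 2 = 1 - X],
    started at 0. *)
Fixpoint sqrt_iter (X : bounded_op H H) (n : nat) : bounded_op H H :=
  if n is n'.+1 then one_half *: (X + comp_op (sqrt_iter X n') (sqrt_iter X n')) else 0.

(** The same iteration for the number 1 in place of [X]. It increases to 1, and its
    increments dominate those of the operator iteration. *)
Fixpoint sqrt_scal (n : nat) : R := if n is n'.+1 then (1 + sqrt_scal n' ^+ 2) / 2 else 0.

Lemma sqrt_iterS X n x :
  sqrt_iter X n.+1 x = one_half *: (X x + sqrt_iter X n (sqrt_iter X n x)).
Proof. by []. Qed.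

Lemma sqrt_scal_bnd n : 0 <= sqrt_scal n <= 1.
Proof.
elim: n => [|n /andP[h1 h2]] /=; first by rewrite lexx ler01.
apply/andP; split; nra.
Qed.

Lemma sqrt_scal_rate n : (1 - sqrt_scal n) * n.+2%:R <= 2.
Proof.
elim: n => [|n ih] /=; first by rewrite subr0 mul1r.
have /andP[h1 h2] := sqrt_scal_bnd n.
set y := sqrt_scal n in ih h1 h2 *; rewrite -(natr1 n.+2).
set N := _%:R in ih *.
have N0 : 0 <= N by rewrite ler0n.
have : 0 <= (2 - (1 - y) * N) * (1 + y) by rewrite mulr_ge0//; lra.
have : 0 <= (1 - y) ^+ 2 by exact: sqr_ge0.
lra.
Qed.

Variables (X : bounded_op H H) (eta : R).
Hypothesis eta01 : 0 <= eta <= 1.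
Hypothesis Xeta : forall x, nrm (X x) <= eta * nrm x.

Lemma sqrt_iter_eta n x : nrm (sqrt_iter X n x) <= eta * nrm x.
Proof.
have /andP[e0 e1] := eta01.
elim: n x => [|n ih] x; first by rewrite [sqrt_iter X 0 x]/= nrm0 mulr_ge0 ?nrm_ge0.
rewrite sqrt_iterS nrm_half ler_pdivrMr//.
have := nrmD (X x) (sqrt_iter X n (sqrt_iter X n x)).
have := Xeta x; have := ih (sqrt_iter X n x); have := ih x; have := nrm_ge0 x.
have := nrm_ge0 (sqrt_iter X n x).
nra.
Qed.

Lemma sqrt_iter_scal n x : nrm (sqrt_iter X n x) <= sqrt_scal n * nrm x.
Proof.
have /andP[e0 e1] := eta01.
elim: n x => [|n ih] x; first by rewrite [sqrt_iter X 0 x]/= nrm0 mul0r.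
rewrite sqrt_iterS nrm_half/=.
have := nrmD (X x) (sqrt_iter X n (sqrt_iter X n x)).
have /andP[h1 h2] := sqrt_scal_bnd n.
have := Xeta x; have := ih (sqrt_iter X n x); have := ih x; have := nrm_ge0 x.
have := nrm_ge0 (sqrt_iter X n x).
nra.
Qed.

(** By induction, from the factorization
    [a ^ 2 - b ^ 2 = a (a - b) + (a - b) b] of consecutive iterates. *)
Lemma sqrt_iter_step n x : nrm (sqrt_iter X n.+1 x - sqrt_iter X n x) <=
  (sqrt_scal n.+1 - sqrt_scal n) * nrm x.
Proof.
have /andP[e0 e1] := eta01.
elim: n x => [|n ih] x.
  rewrite sqrt_iterS [sqrt_iter X 0 x]/= [sqrt_iter X 0 _]/= addr0 subr0 nrm_half/=.
  have := Xeta x; have := nrm_ge0 x; nra.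
set a := sqrt_iter X n.+1; set b := sqrt_iter X n.
have -> : sqrt_iter X n.+2 x - a x = one_half *: (a (a x - b x) + (a (b x) - b (b x))).
  rewrite sqrt_iterS -/a {2}/a sqrt_iterS -/b -scalerBr opB.
  by rewrite opprD addrACA subrr add0r addrA subrK.
rewrite nrm_half.
have h5 := nrmD (a (a x - b x)) (a (b x) - b (b x)).
have h4 : nrm (a (b x) - b (b x)) <= (sqrt_scal n.+1 - sqrt_scal n) * nrm (b x) := ih (b x).
have h3 : nrm (a x - b x) <= (sqrt_scal n.+1 - sqrt_scal n) * nrm x := ih x.
have abx : nrm (a (a x - b x)) <= sqrt_scal n.+1 * nrm (a x - b x) := sqrt_iter_scal n.+1 _.
have bx : nrm (b x) <= sqrt_scal n * nrm x := sqrt_iter_scal n x.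
have tS : sqrt_scal n.+2 = (1 + sqrt_scal n.+1 ^+ 2) / 2 by [].
have tE : sqrt_scal n.+1 = (1 + sqrt_scal n ^+ 2) / 2 by [].
have /andP[h1 h2] := sqrt_scal_bnd n; have /andP[t0 t1] := sqrt_scal_bnd n.+1.
rewrite tS; clearbody a b.
set s := sqrt_scal n in h1 h2 h3 h4 bx tE *; set t := sqrt_scal n.+1 in h3 h4 abx t0 t1 tE *.
clearbody s t.
(* t - s = (1 - s) ^ 2 / 2. *)
have st : 0 <= t - s by rewrite tE; have := sqr_ge0 (1 - s); lra.
have h6 : (t - s) * nrm (b x) <= (t - s) * (s * nrm x) by rewrite ler_wpM2l.
have h7 : t * nrm (a x - b x) <= t * ((t - s) * nrm x) by rewrite ler_wpM2l.
have h8 : ((1 + t ^+ 2) / 2 - t) * nrm x = (t - s) * (t + s) / 2 * nrm x.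
  by rewrite {2}tE; congr (_ * _); lra.
rewrite h8; lra.
Qed.

Lemma sqrt_iter_dist n j x : nrm (sqrt_iter X (n + j)%N x - sqrt_iter X n x) <=
  (sqrt_scal (n + j)%N - sqrt_scal n) * nrm x.
Proof.
elim: j => [|j ih]; first by rewrite addn0 !subrr nrm0 mul0r.
have := nrm_tri (sqrt_iter X (n + j)%N x) (sqrt_iter X (n + j).+1 x) (sqrt_iter X n x).
by have := sqrt_iter_step (n + j)%N x; rewrite addnS; lra.
Qed.

Lemma sqrt_iter_dist1 n j x : nrm (sqrt_iter X (n + j)%N x - sqrt_iter X n x) <=
  2 / n.+2%:R * nrm x.
Proof.
rewrite (le_trans (sqrt_iter_dist n j x))// ler_wpM2r ?nrm_ge0//.
rewrite ler_pdivlMr ?ltr0n//.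
rewrite (le_trans _ (sqrt_scal_rate n))// ler_wpM2r ?ler0n//.
by have /andP[_] := sqrt_scal_bnd (n + j); lra.
Qed.

Lemma sqrt_iter_cauchy x : norm_cauchy (fun n => sqrt_iter X n x).
Proof.
move=> e e0.
pose N := Num.bound (4 * nrm x / e).
have hN : 4 * nrm x < e * N.+2%:R.
  have : 4 * nrm x / e < N.+2%:R.
    by rewrite (lt_trans (archi_boundP _)) ?ltr_nat// divr_ge0 ?mulr_ge0 ?nrm_ge0// ltW.
  by rewrite ltr_pdivrMr// (mulrC e).
exists N => m n /subnKC <- /subnKC <-.
have := sqrt_iter_dist1 N (m - N)%N x; have := sqrt_iter_dist1 N (n - N)%N x.
have := nrm_tri (sqrt_iter X N x) (sqrt_iter X (N + (m - N))%N x) (sqrt_iter X (N + (n - N))%N x).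
rewrite (nrm_subC (sqrt_iter X N x)).
have : 2 / N.+2%:R * nrm x < e / 2.
  by rewrite mulrAC ltr_pdivrMr ?ltr0n//; lra.
set q := 2 / _ * _; lra.
Qed.

(** The square root [P] of [1 - X], with the properties that pass to the limit
    of the iteration. *)
Lemma exists_sqrt : exists P : bounded_op H H,
  [/\ forall x, P (P x) = x - X x,
      forall x, nrm (x - P x) <= eta * nrm x,
      (forall Z : bounded_op H H, (forall x, Z (X x) = X (Z x)) ->
        forall x, Z (P x) = P (Z x)) &
      (symmetric_op X -> symmetric_op P)].
Proof.
have /andP[e0 e1] := eta01.
have /choice[y yP] (x : H) : exists l, norm_cvg (fun n => sqrt_iter X n x) l.
  exact/norm_cauchy_cvg/sqrt_iter_cauchy.
have ylin : linear y.
  move=> a u v; apply: norm_cvg_unique (yP _) _.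
  have -> : (fun n => sqrt_iter X n (a *: u + v)) =
            (fun n => a *: sqrt_iter X n u + sqrt_iter X n v).
    by apply/funext => n; rewrite opP.
  apply: norm_cvgD => //.
  apply: (norm_cvg_lin (f := fun z => a *: z) (M := cabs a)) => //.
    by move=> b z w; rewrite scalerDr !scalerA mulrC.
  by move=> z; rewrite nrmZ.
have yeta x : nrm (y x) <= eta * nrm x.
  by apply: norm_cvg_nrm_le (yP x) _; exists 0%N => n _; exact: sqrt_iter_eta.
have [Y YlimE] := exists_op ylin yeta.
have YP x : norm_cvg (fun n => sqrt_iter X n x) (Y x) by rewrite YlimE.
have YYP x : norm_cvg (fun n => sqrt_iter X n (sqrt_iter X n x)) (Y (Y x)).
  move=> e ee0.
  have [|N hN] := YP x (e / 2); first by lra.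
  have [|M hM] := YP (Y x) (e / 2); first by lra.
  exists (maxn N M) => n; rewrite geq_max => /andP[/hN a /hM b].
  have := nrm_tri (sqrt_iter X n (Y x)) (sqrt_iter X n (sqrt_iter X n x)) (Y (Y x)).
  rewrite -opB; have := sqrt_iter_scal n (sqrt_iter X n x - Y x).
  have /andP[h1 h2] := sqrt_scal_bnd n.
  have := nrm_ge0 (sqrt_iter X n x - Y x); nra.
have YE x : Y x + Y x = X x + Y (Y x).
  apply: (norm_cvg_unique
    (u := fun n => sqrt_iter X (n + 1)%N x + sqrt_iter X (n + 1)%N x)).
    by apply: norm_cvgD; exact: (norm_cvg_shift (u := fun n => sqrt_iter X n x)).
  have -> : (fun n => sqrt_iter X (n + 1)%N x + sqrt_iter X (n + 1)%N x) =
            (fun n => X x + sqrt_iter X n (sqrt_iter X n x)).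
    by apply/funext => n; rewrite addn1 sqrt_iterS half_double.
  by apply: norm_cvgD => //; exact: norm_cvg_cst.
have [P PE] : exists P : bounded_op H H, forall x, P x = x - Y x.
  by exists (id_op H - Y).
exists P; split.
- move=> x; have -> : x - X x = x + Y (Y x) - (Y x + Y x).
    by rewrite YE [X x + _]addrC opprD addrA addrK.
  by rewrite !PE opB opprB addrA opprD addrA [x + _ - _]addrAC.
- by move=> x; rewrite PE subKr YlimE.
- move=> Z ZX x.
  have ZXn n z : Z (sqrt_iter X n z) = sqrt_iter X n (Z z).
    elim: n z => [|n ih] z; first exact: op0.
    by rewrite !sqrt_iterS opZ opD ZX !ih.
  rewrite !PE opB; congr (_ - _).
  apply: (norm_cvg_unique (u := fun n => sqrt_iter X n (Z x))); last exact: YP.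
  have -> : (fun n => sqrt_iter X n (Z x)) = Z \o (fun n => sqrt_iter X n x).
    by apply/funext => n; rewrite /= ZXn.
  apply: (norm_cvg_lin (M := op_nrm Z)) => //; first exact: bounded_op_linear.
  exact: nrm_op.
- move=> sX x z; rewrite !PE innerBl innerBr; congr (_ - _).
  have sXn n u v : inner (sqrt_iter X n u) v = inner u (sqrt_iter X n v).
    elim: n u v => [|n ih] u v; first by rewrite inner0l inner0r.
    rewrite !sqrt_iterS innerZl innerZr innerDl innerDr sX !ih.
    by rewrite conj_Creal// complex_real.
  by apply: (inner_lim_eq (YP x) (norm_cvg_cst z) (norm_cvg_cst x) (YP z)).
Qed.

End sqrt.

(** * Splitting the space along a symmetric operator *)

Section spectral.
Variables (R : realType) (H : hilbertType R).

Lemma kernel_closed (K : hilbertType R) (A : bounded_op H K) :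
  closed_subspace [set x | A x = 0].
Proof. by rewrite -perp_range_adjoint; exact: perp_closed. Qed.

(** With [P] the absolute value of [S], that is the square root of [S ^ 2], let
    [W] be the kernel of [P - S]. On [W], [S = P] is positive. Since
    [(P - S) (P + S) = P ^ 2 - S ^ 2 = 0], the operator [P + S] maps into [W], and by
    symmetry it vanishes on the complement of [W], where therefore [S = - P] is
    negative. *)
Lemma spectral_cut_normalized (S : bounded_op H H) : symmetric_op S ->
  (forall x, nrm (S x) <= nrm x) -> exists W, [/\ closed_subspace W,
    (forall w, W w -> 0 <= re_inner (S w) w) & (forall x, perp W x -> re_inner (S x) x <= 0)].
Proof.
move=> sS S1.
pose X : bounded_op H H := id_op H - comp_op S S.
have XE x : X x = x - S (S x) by [].
have [||P [PP P1 Pcomm Psym]] := @exists_sqrt R H X 1.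
- by rewrite ler01 lexx.
- move=> x; rewrite mul1r XE -(@ler_pXn2r _ 2)// ?nnegrE ?nrm_ge0// nrm2B.
  have -> : re_inner x (S (S x)) = nrm (S x) ^+ 2 by rewrite -re_innerxx /re_inner -sS.
  have : nrm (S (S x)) ^+ 2 <= nrm (S x) ^+ 2 by rewrite ler_pXn2r ?nnegrE ?nrm_ge0.
  by have := sqr_ge0 (nrm (S x)); lra.
have {}PP x : P (P x) = S (S x) by rewrite PP XE subKr.
have sP : symmetric_op P.
  by apply: Psym => x y; rewrite !XE innerBl innerBr !sS.
have SP x : S (P x) = P (S x) by apply: Pcomm => z; rewrite !XE opB.
have Ppos x : 0 <= re_inner (P x) x.
  rewrite -{1}(subKr x (P x)) re_innerDl re_innerNl re_innerxx.
  have := re_inner_le (x - P x) x; have := P1 x; have := nrm_ge0 x.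
  have := ler_norm (re_inner (x - P x) x); nra.
pose W := [set x | (P - S) x = 0].
have WE x : W x <-> P x = S x.
  split=> h; first by apply/eqP; rewrite -subr_eq0; apply/eqP; exact: h.
  by have : P x - S x = 0 by rewrite h subrr.
have cW : closed_subspace W by exact: kernel_closed.
have WW x : W (P x + S x).
  by apply/WE; rewrite !opD PP SP addrC.
exists W; split=> // [w /WE <-|x /perpP xW]; first exact: Ppos.
have /eqP : P x + S x = 0.
  apply: inner_self0.
  have -> : inner (P x + S x) (P x + S x) = inner x (P (P x + S x) + S (P x + S x)).
    by rewrite innerDl sP sS -innerDr.
  by apply: xW; exact: WW.
rewrite addrC addr_eq0 => /eqP ->; rewrite re_innerNl oppr_le0.
exact: Ppos.
Qed.

(** The spectral subspace of [T] for the half-line above [t], without a spectral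
    measure: cut [T - t] at 0 after scaling it to a contraction. *)
Lemma spectral_cut (T : bounded_op H H) (t : R) : symmetric_op T ->
  exists W, [/\ closed_subspace W,
    (forall w, W w -> t * nrm w ^+ 2 <= re_inner (T w) w) &
    (forall x, perp W x -> re_inner (T x) x <= t * nrm x ^+ 2)].
Proof.
move=> sT; pose M := op_nrm T + `|t| + 1.
have M0 : 0 < M by rewrite /M; have := op_nrm_ge0 T; have := normr_ge0 t; lra.
pose S : bounded_op H H := (M^-1)%:C *: (T - t%:C *: id_op H).
have SE x : S x = (M^-1)%:C *: (T x - t%:C *: x) by [].
have re_innerS x : re_inner (S x) x = M^-1 * (re_inner (T x) x - t * nrm x ^+ 2).
  by rewrite SE re_innerZl re_innerDl re_innerNl re_innerZl re_innerxx.
have [x y|x|W [cW h1 h2]] := @spectral_cut_normalized S.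
- by rewrite !SE innerZl innerZr innerBl innerBr sT innerZl innerZr !conj_Creal// complex_real.
- rewrite SE nrmZ cabs_real ?invr_ge0 ?(ltW M0)// ler_pdivrMl//.
  have := nrmB (T x) (t%:C *: x); rewrite nrmZ.
  have -> : cabs t%:C = `|t|.
    by rewrite /cabs normc_def/= expr0n addr0 sqrtr_sqr.
  by have := nrm_op T x; have := nrm_ge0 x; rewrite /M; nra.
exists W; split=> // [w /h1|x /h2].
  by rewrite re_innerS pmulr_rge0 ?invr_gt0// subr_ge0.
by rewrite re_innerS pmulr_rle0 ?invr_gt0// subr_le0.
Qed.

End spectral.

(** * Images under operators that are bounded below *)

Section images.
Variables (R : realType) (H K : hilbertType R).

Lemma image_linear_subspace (A : bounded_op H K) (W : set H) :
  linear_subspace W -> linear_subspace (A @` W).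
Proof.
move=> lW; split=> [|a _ _ [x Wx <-] [y Wy <-]].
  by exists 0; [exact: lsub0|exact: op0].
by exists (a *: x + y); [exact: lsubZD|exact: opP].
Qed.

Lemma bounded_below_closed_image (A : bounded_op H K) (W : set H) (c : R) :
  closed_subspace W -> 0 < c -> (forall w, W w -> c * nrm w <= nrm (A w)) ->
  closed_subspace (A @` W).
Proof.
move=> cW c0 hA; have lW := cW.1; split; first exact: image_linear_subspace.
move=> y /closure_nrm cy.
have /choice[w wP] (n : nat) : exists w, W w /\ nrm (y - A w) < n.+1%:R^-1.
  have [|_ [w Ww <-] h] := cy (n.+1%:R^-1); first by rewrite invr_gt0 ltr0n.
  by exists w.
have wy : norm_cvg (fun n => A (w n)) y.
  move=> e e0.
  have [N _ hN] := near_infty_natSinv_lt (PosNum e0).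
  exists N => n /hN/= h; rewrite nrm_subC; exact: lt_trans (wP n).2 h.
have cw : norm_cauchy w.
  move=> e e0.
  have [|N hN] := wy (c * e / 2); first by rewrite !divr_gt0 ?mulr_gt0.
  exists N => m n /hN hm /hN hn.
  have := nrm_tri y (A (w m)) (A (w n)); rewrite (nrm_subC y) -opB.
  have := hA _ (lsubB lW (wP m).1 (wP n).1) => h1 h2.
  have : c * nrm (w m - w n) < c * e by lra.
  by rewrite ltr_pM2l.
have [l wl] := norm_cauchy_cvg cw.
exists l; first by apply: closed_subspace_lim cW _ wl => n; exact: (wP n).1.
apply: (norm_cvg_unique (u := fun n => A (w n))) => //.
apply: (norm_cvg_lin (f := A) (M := op_nrm A)) => //; first exact: bounded_op_linear.
exact: nrm_op.
Qed.

End images.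

(** * Unitaries close to a given operator *)

Section polar.
Variables (R : realType) (K : hilbertType R).

(** The range is closed because [P] is bounded below, and dense because its
    orthogonal complement is the kernel of [P]. *)
Lemma symmetric_surjective (P : bounded_op K K) (c : R) : symmetric_op P -> 0 < c ->
  (forall x, c * nrm x <= nrm (P x)) -> forall y, exists x, P x = y.
Proof.
move=> sP c0 hP y.
have cr : closed_subspace (P @` setT).
  by apply: (bounded_below_closed_image (c := c)).
have : perp (perp (P @` setT)) y.
  apply/perpP => z /perpP hz.
  have : P z = 0.
    by apply: inner_self0; rewrite sP; apply: hz; exists (P z).
  move=> Pz; have := hP z; rewrite Pz nrm0 pmulr_rle0// => nz.
  have -> : z = 0 by apply/nrm_eq0/eqP; rewrite eq_le nz nrm_ge0.
  by rewrite inner0r.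
by rewrite perp_perp// => -[x _ <-]; exists x.
Qed.

(** The unitary factor in the polar decomposition of [D]: with [P] the square root
    of [adjoint D * D], which is close to 1 because [D] is nearly isometric, take
    [V = D * P ^ -1]. *)
Lemma exists_near_unitary (D : bounded_op K K) (eta : R) : 0 <= eta -> eta <= 1 / 2 ->
  (forall y, exists x, D x = y) ->
  (forall y z, cabs (inner (D y) (D z) - inner y z) <= eta * nrm y * nrm z) ->
  exists V : bounded_op K K, unitary V /\ forall y, nrm (V y - D y) <= 4 * eta * nrm y.
Proof.
move=> eta0 eta1 surjD hD.
pose X : bounded_op K K := id_op K - comp_op (adjoint D) D.
have XE x : X x = x - adjoint D (D x) by [].
have innerX y z : inner (X y) z = inner y z - inner (D y) (D z).
  by rewrite XE innerBl -adjointPr.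
have sX : symmetric_op X.
  by move=> y z; rewrite innerX XE innerBr -adjointP.
have [||P [PP PX _ /(_ sX) sP]] := @exists_sqrt R K X eta.
- by rewrite eta0/=; lra.
- move=> y; have [->|n0] := eqVneq (X y) 0.
    by rewrite nrm0 mulr_ge0 ?nrm_ge0.
  rewrite -(ler_pM2r (nrm_gt0 n0)) -expr2.
  have := hD y (X y); rewrite -(cabsN (_ - _)) opprB -innerX inner_nrm.
  by rewrite cabs_real ?sqr_ge0.
have {}PP x : P (P x) = adjoint D (D x) by rewrite PP XE subKr.
have P1 x : 1 / 2 * nrm x <= nrm (P x).
  have := nrm_ge_sub x (x - P x); rewrite subKr.
  by have := PX x; have := nrm_ge0 x; nra.
have /choice[r rP] := symmetric_surjective sP (ltac:(lra) : 0 < 1 / 2) P1.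
have Pinj x y : P x = P y -> x = y.
  move=> xy; apply/eqP; rewrite -subr_eq0; apply/eqP/nrm_eq0/eqP.
  rewrite eq_le nrm_ge0 andbT; have := P1 (x - y).
  by rewrite opB xy subrr nrm0; lra.
have rlin : linear r.
  by move=> a x y; apply: Pinj; rewrite opP !rP.
(* D and P have the same Gram form, hence D * P ^ -1 is isometric. *)
have DD x y : inner (D x) (D y) = inner (P x) (P y).
  by rewrite sP PP adjointP.
pose v y := D (r y).
have vlin : linear v by move=> a x y; rewrite /v rlin opP.
have viso x y : inner (v x) (v y) = inner x y by rewrite DD !rP.
have vn x : nrm (v x) = nrm x.
  by apply: nrm_of_inner; rewrite viso.
have [|V VE] := @exists_op _ _ _ v 1 vlin; first by move=> x; rewrite vn mul1r.
exists V; split; first split.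
- by move=> x y; rewrite !VE viso.
- apply/seteqP; split=> // y _; have [x <-] := surjD y.
  exists (P x) => //; rewrite VE /v; congr (D _); apply: Pinj; exact: rP.
move=> y; rewrite VE /v; set z := r y.
have yE : y = P z by rewrite rP.
have -> : D z - D y = D (z - P z) by rewrite opB /z rP.
have nD x : nrm (D x) <= 2 * nrm x.
  rewrite -(@ler_pXn2r _ 2)// ?nnegrE ?nrm_ge0 ?mulr_ge0 ?nrm_ge0//.
  have := hD x x; rewrite !inner_nrm -rmorphB/=.
  have := cabs_ge_Re (nrm (D x) ^+ 2 - nrm x ^+ 2)%:C; rewrite /=.
  have := ler_norm (nrm (D x) ^+ 2 - nrm x ^+ 2).
  have := sqr_ge0 (nrm x); rewrite exprMn; nra.
have := nD (z - P z); have := PX z; have := P1 z; rewrite -yE.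
have := nrm_ge0 y; have := nrm_ge0 z; nra.
Qed.

End polar.

(** * Isometries between subspaces of the same dimension *)

Section isometry.
Variables (R : realType).

(** Sequences stand for the topology of the product of [H] and [K]. *)
Definition graph_closure (H K : hilbertType R) (G : H -> K -> Prop) x y :=
  exists u v, [/\ (forall n, G (u n) (v n)), norm_cvg u x & norm_cvg v y].

Lemma graph_closure_total (H K : hilbertType R) (G : H -> K -> Prop) x :
  (forall x y x' y', G x y -> G x' y' -> G (x - x') (y - y')) ->
  (forall x y, G x y -> nrm x = nrm y) ->
  closure [set x | exists y, G x y] x -> exists y, graph_closure G x y.
Proof.
move=> GB Gn /closure_nrm cx.
have /choice[uv uvP] (n : nat) : exists uv : H * K, G uv.1 uv.2 /\ nrm (x - uv.1) < n.+1%:R^-1.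
  have [|u [v Guv] h] := cx (n.+1%:R^-1); first by rewrite invr_gt0 ltr0n.
  by exists (u, v).
have ux : norm_cvg (fun n => (uv n).1) x.
  move=> e e0.
  have [N _ hN] := near_infty_natSinv_lt (PosNum e0).
  exists N => n /hN/= h; rewrite nrm_subC; exact: lt_trans (uvP n).2 h.
have [|y vy] := @norm_cauchy_cvg _ _ (fun n => (uv n).2).
  move=> e e0; have [|N hN] := ux (e / 2); first by lra.
  exists N => m n /hN hm /hN hn.
  rewrite -(Gn _ _ (GB _ _ _ _ (uvP m).1 (uvP n).1)).
  by have := nrm_tri x (uv m).1 (uv n).1; rewrite (nrm_subC x); lra.
by exists y, (fun n => (uv n).1), (fun n => (uv n).2); split=> // n; exact: (uvP n).1.
Qed.

Variables (H K : hilbertType R).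

(** The impredicative form makes every linear property of the pairs [(e, f e)] pass
    to the relation that they generate. *)
Definition span_graph (B : set H) (f : H -> K) x y := forall P : H -> K -> Prop,
  P 0 0 -> (forall a x y x' y', P x y -> P x' y' -> P (a *: x + x') (a *: y + y')) ->
  (forall e, B e -> P e (f e)) -> P x y.

(** A bijection [f] between orthonormal bases generates a linear relation that
    preserves inner products. Its closure is the graph of an isometry of [X] onto
    [Y]: it is total on [X] by completeness, and symmetrically onto [Y]. *)
Lemma exists_partial_isometry (X : set H) (Y : set K) : closed_subspace X ->
  closed_subspace Y -> hilbert_dim X #= hilbert_dim Y ->
  exists u : bounded_op H K, [/\ forall x, X x -> Y (u x),
    forall x x', X x -> X x' -> inner (u x) (u x') = inner x x',
    forall y, Y y -> exists2 x, X x & u x = y &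
    forall x, perp X x -> u x = 0].
Proof.
move=> cX cY; have := hilbert_dimP cX; have := hilbert_dimP cY.
set C := hilbert_dim Y; set B := hilbert_dim X => -[oC sC] [oB sB].
move=> /card_set_bijP[f [fB finj fsurj]].
pose G := span_graph B f.
have G0 : G 0 0 by move=> P.
have GL a x y x' y' : G x y -> G x' y' -> G (a *: x + x') (a *: y + y').
  by move=> h h' P P0 PL PB; apply: (PL); [exact: h|exact: h'].
have GB e : B e -> G e (f e) by move=> Be P P0 PL PB; exact: PB.
have Gsub x y x' y' : G x y -> G x' y' -> G (x - x') (y - y').
  by move=> h h'; have := GL (-1) _ _ _ _ h' h; rewrite !scaleN1r ![- _ + _]addrC.
have Gi1 x y e : G x y -> B e -> inner y (f e) = inner x e.
  move=> Gxy; move: e.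
  apply: (Gxy (fun x y => forall e, B e -> inner y (f e) = inner x e)).
  - by move=> e _; rewrite !inner0l.
  - move=> a x1 y1 x2 y2 h1 h2 e Be.
    by rewrite !innerDl !innerZl h1// h2.
  - move=> e' Be' e Be; rewrite oB// oC; [|exact: fB..].
    congr ((_ : bool)%:R); apply/eqP/eqP => [h|->//].
    by apply: finj; rewrite ?inE.
have Gi x y x' y' : G x y -> G x' y' -> inner y y' = inner x x'.
  move=> Gxy Gxy'; apply: (Gxy' (fun x' y' => inner y y' = inner x x')).
  - by rewrite !inner0r.
  - by move=> a x1 y1 x2 y2 h1 h2; rewrite !innerDr !innerZr h1 h2.
  - by move=> e Be; exact: Gi1.
have Gn x y : G x y -> nrm x = nrm y.
  by move=> h; apply: nrm_of_inner; rewrite (Gi _ _ _ _ h h).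
have GX x y : G x y -> X x.
  move=> h; apply: (h (fun x _ => X x)); [exact: lsub0 cX.1|
    by move=> *; apply: lsubZD => //; exact: cX.1|].
  by move=> e Be; rewrite -sB; apply: subset_closure; exact: sub_linear_span.
have GY x y : G x y -> Y y.
  move=> h; apply: (h (fun _ y => Y y)); [exact: lsub0 cY.1|
    by move=> *; apply: lsubZD => //; exact: cY.1|].
  by move=> e Be; rewrite -sC; apply: subset_closure; apply: sub_linear_span; exact: fB.
pose Gb := graph_closure G.
have Gbi x y x' y' : Gb x y -> Gb x' y' -> inner y y' = inner x x'.
  move=> [u [v [Guv ux vy]]] [u' [v' [Guv' ux' vy']]].
  by apply: (inner_lim_eq vy vy' ux ux') => n; exact: Gi.
have GbY x y : Gb x y -> Y y.
  move=> [u [v [Guv ux vy]]]; apply: closed_subspace_lim cY _ vy => n.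
  exact: GY (Guv n).
have GbX x y : Gb x y -> X x.
  move=> [u [v [Guv ux vy]]]; apply: closed_subspace_lim cX _ ux => n.
  exact: GX (Guv n).
have tot x : X x -> exists y, Gb x y.
  rewrite -sB => cx; apply: graph_closure_total => //.
  apply: closure_subset cx; apply: linear_span_min.
    split=> [|a x1 x2 [y1 h1] [y2 h2]]; first by exists 0.
    by exists (a *: y1 + y2); exact: GL.
  by move=> e Be; exists (f e); exact: GB.
have surj y : Y y -> exists x, Gb x y.
  rewrite -sC => cy.
  have [|||x [v [u [Guv vy ux]]]] := @graph_closure_total K H (fun y x => G x y) y.
  - by move=> x1 y1 x2 y2; exact: Gsub.
  - by move=> y1 x1 /Gn.
  - apply: closure_subset cy; apply: linear_span_min.
      split=> [|a y1 y2 [x1 h1] [x2 h2]]; first by exists 0.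
      by exists (a *: x1 + x2); exact: GL.
    by move=> e /fsurj[e' Be' <-]; exists e'; exact: GB.
  - by exists x, u, v.
have /choice[g gP] (x : H) : exists y, Gb (proj X x) y.
  by apply: tot; exact: proj_in.
have uniq_g x y : Gb (proj X x) y -> y = g x.
  move=> h; apply/eqP; rewrite -subr_eq0; apply/eqP/inner_self0.
  rewrite innerBl !innerBr.
  by rewrite !(Gbi _ _ _ _ h h,
    Gbi _ _ _ _ h (gP x), Gbi _ _ _ _ (gP x) h, Gbi _ _ _ _ (gP x) (gP x)) !subrr.
have GbL a x y x' y' : Gb x y -> Gb x' y' -> Gb (a *: x + x') (a *: y + y').
  move=> [u [v [Guv ux vy]]] [u' [v' [Guv' ux' vy']]].
  exists (fun n => a *: u n + u' n), (fun n => a *: v n + v' n); split.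
  - by move=> n; exact: GL.
  - apply: norm_cvgD => //; apply: (norm_cvg_lin (f := fun z => a *: z) (M := cabs a)) => //.
      by move=> b z w; rewrite scalerDr !scalerA mulrC.
    by move=> z; rewrite nrmZ.
  - apply: norm_cvgD => //; apply: (norm_cvg_lin (f := fun z => a *: z) (M := cabs a)) => //.
      by move=> b z w; rewrite scalerDr !scalerA mulrC.
    by move=> z; rewrite nrmZ.
have glin : linear g.
  by move=> a x y; apply/esym/uniq_g; rewrite proj_linear//; exact: GbL.
have gi x y : inner (g x) (g y) = inner (proj X x) (proj X y) by exact: Gbi.
have gn x : nrm (g x) = nrm (proj X x).
  by apply: nrm_of_inner; rewrite gi.
have [|u uE] := @exists_op _ _ _ g 1 glin.
  by move=> x; rewrite gn mul1r nrm_proj_le.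
exists u; split.
- by move=> x Xx; rewrite uE; exact: GbY (gP x).
- by move=> x x' Xx Xx'; rewrite !uE gi !proj_id.
- move=> y /surj[x h]; exists x; first exact: GbX h.
  by rewrite uE; apply/esym/uniq_g; rewrite proj_id//; exact: GbX h.
- by move=> x Xx; rewrite uE; apply: nrm_eq0; rewrite gn proj_perp0// nrm0.
Qed.

End isometry.

(** * Unitary orbits and their closures *)

Section unitaries.
Variables (R : realType) (H : hilbertType R).
Implicit Types U : bounded_op H H.

Lemma unitary_nrm U x : unitary U -> nrm (U x) = nrm x.
Proof.
by move=> [iU _]; apply: nrm_of_inner; rewrite iU.
Qed.

Lemma unitary_adjointK U x : unitary U -> adjoint U (U x) = x.
Proof. by move=> [iU _]; apply: inner_ext => z; rewrite -adjointP iU. Qed.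

Lemma unitary_adjointVK U x : unitary U -> U (adjoint U x) = x.
Proof.
move=> uU; have [y _ <-] : range U x by rewrite uU.2.
by rewrite unitary_adjointK.
Qed.

Lemma unitary_adjoint U : unitary U -> unitary (adjoint U).
Proof.
move=> uU; split=> [x y|]; first by rewrite adjointP adjointK unitary_adjointVK.
by apply/seteqP; split=> // x _; exists (U x) => //; exact: unitary_adjointK.
Qed.

Lemma unitary_inv U : unitary U -> inv_op U = adjoint U.
Proof.
move=> uU; rewrite /inv_op; case: xgetP => [B _ [BU UB]|/(_ (adjoint U))]; last first.
  case; split; apply: op_ext => x; [exact: unitary_adjointK|exact: unitary_adjointVK].
apply: op_ext => x; rewrite -{1}(unitary_adjointVK x uU).
by have := congr1 (fun f : bounded_op H H => f (adjoint U x)) BU.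
Qed.

End unitaries.

Section orbits.
Variables (R : realType) (H K : hilbertType R).

(** [U] stands for the inverse of the unitary in the definition of the orbit. *)
Lemma closed_orbit2P (A B : bounded_op H K) : closed_orbit2 A B <->
  forall e : R, 0 < e -> exists (V : bounded_op K K) (U : bounded_op H H),
    [/\ unitary V, unitary U & forall x, nrm (B x - V (A (U x))) <= e * nrm x].
Proof.
split=> [/closure_op h e /h[_ [V uV [U uU <-]] d]|h].
  exists V, (adjoint U); split=> //; first exact: unitary_adjoint.
  by move=> x; have := d x; rewrite /= unitary_inv.
apply/closure_op => e /h[V [U [uV uU d]]].
exists (comp_op (comp_op V A) (inv_op (adjoint U))).
  by exists V => //; exists (adjoint U) => //; exact: unitary_adjoint.
by move=> x; rewrite unitary_inv ?adjointK//; exact: unitary_adjoint.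
Qed.

Lemma closed_unitary_orbitP (X Y : bounded_op H H) : closed_unitary_orbit X Y <->
  forall e : R, 0 < e -> exists2 U : bounded_op H H, unitary U &
    forall x, nrm (Y x - adjoint U (X (U x))) <= e * nrm x.
Proof.
split=> [/closure_op h e /h[_ [U uU <-] d]|h].
  exists (adjoint U); first exact: unitary_adjoint.
  by move=> x; have := d x; rewrite /= unitary_inv// adjointK.
apply/closure_op => e /h[U uU d].
exists (comp_op (comp_op (adjoint U) X) (inv_op (adjoint U))).
  by exists (adjoint U) => //; exact: unitary_adjoint.
by move=> x; rewrite unitary_inv ?adjointK//; exact: unitary_adjoint.
Qed.

Lemma nrm_le_inner (L : hilbertType R) (z : L) (c : R) : 0 <= c ->
  (forall w, cabs (inner z w) <= c * nrm w) -> nrm z <= c.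
Proof.
move=> c0 h; have [->|z0] := eqVneq z 0; first by rewrite nrm0.
rewrite -(ler_pM2r (nrm_gt0 z0)) -expr2.
by have := h z; rewrite inner_nrm cabs_real ?sqr_ge0.
Qed.

(** If [B] is close to [V A U], then [B^* B] is close to
    [U^* A^* V^* V A U = U^-1 (A^* A) U]. *)
Lemma gram_orbit (A B : bounded_op H K) : closed_orbit2 A B ->
  closed_unitary_orbit (comp_op (adjoint A) A) (comp_op (adjoint B) B).
Proof.
move=> /closed_orbit2P h; apply/closed_unitary_orbitP => e e0.
pose M := 2 * op_nrm B + 1.
have M0 : 0 < M by rewrite /M; have := op_nrm_ge0 B; lra.
pose d := Num.min 1 (e / M).
have d0 : 0 < d by rewrite lt_min ltr01 divr_gt0.
have d1 : d <= 1 by rewrite ge_min lexx.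
have dM : d * M <= e by rewrite -ler_pdivlMr// ge_min lexx orbT.
have [V [U [uV uU hd]]] := h d d0.
exists U => // x; rewrite !comp_opE.
apply: nrm_le_inner; first by rewrite mulr_ge0 ?nrm_ge0// ltW.
move=> w; set A' := comp_op V (comp_op A U).
have -> : inner (adjoint B (B x) - adjoint U (adjoint A (A (U x)))) w =
    inner (B x) (B w - A' w) + inner (B x - A' x) (A' w).
  rewrite innerBl -!adjointPr innerBl innerBr addrA subrK.
  by rewrite /A' !comp_opE uV.1.
have := cabsD (inner (B x) (B w - A' w)) (inner (B x - A' x) (A' w)).
have := cauchy_schwarz (B x) (B w - A' w).
have := cauchy_schwarz (B x - A' x) (A' w).
have nBx := nrm_op B x; have nBw := nrm_op B w.
have hx : nrm (B x - A' x) <= d * nrm x := hd x.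
have hw : nrm (B w - A' w) <= d * nrm w := hd w.
have nA' : nrm (A' w) <= (op_nrm B + 1) * nrm w.
  have := nrm_ge_sub (A' w) (B w); rewrite nrm_subC.
  have := nrm_ge0 w; nra.
have n0 := nrm_ge0 x; have n1 := nrm_ge0 w.
have p1 : nrm (B x) * nrm (B w - A' w) <= (op_nrm B * nrm x) * (d * nrm w).
  by apply: ler_pM => //; exact: nrm_ge0.
have p2 : nrm (B x - A' x) * nrm (A' w) <= (d * nrm x) * ((op_nrm B + 1) * nrm w).
  by apply: ler_pM => //; exact: nrm_ge0.
have p3 : d * M * (nrm x * nrm w) <= e * (nrm x * nrm w).
  by rewrite ler_wpM2r// mulr_ge0.
move: p3; rewrite /M; lra.
Qed.

(** Let [V0] be a closed subspace of least codimension in the range of [A], and let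
    [A] be bounded below by [c] on a subspace [W0] mapped onto [V0]. An operator
    closer than [c / 2] to [V A U] is still bounded below on the preimage [W] of
    [W0] under [U], so [B W] is closed in the range of [B]. Its codimension is at
    most that of [V0]: a vector [y = V A U w] orthogonal to [B w] satisfies
    [|y| <= |B w - y| <= |y| / 2]. *)
Lemma iota_f_semicontinuous (A : bounded_op H K) : exists2 c : R, 0 < c &
  forall (B : bounded_op H K) (V : bounded_op K K) (U : bounded_op H H),
    unitary V -> unitary U -> (forall x, nrm (B x - V (A (U x))) <= c * nrm x) ->
    iota_f B #<= iota_f A.
Proof.
have [V0 [cV0 V0A e0]] := iota_f_attained A.
have [W0 [c [cW0 c0 hW0 _ AW0]]] := closed_image_section cV0 V0A.
exists (c / 2); first by rewrite divr_gt0.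
move=> B V U uV uU h.
pose W := [set x | W0 (U x)].
have cW : closed_subspace W by exact: preimage_closed_subspace.
have nA w : W w -> c * nrm w <= nrm (V (A (U w))).
  by move=> /hW0; rewrite !unitary_nrm.
have nB w : W w -> c / 2 * nrm w <= nrm (B w).
  move=> /nA; have := h w; have := nrm_ge_sub (V (A (U w))) (B w).
  by rewrite nrm_subC; lra.
have cBW : closed_subspace (B @` W).
  by apply: bounded_below_closed_image cW _ nB; rewrite divr_gt0.
apply: card_le_trans (iota_f_le cBW _) _; first by move=> _ [w _ <-]; exists w.
rewrite (card_le_eqr e0).
apply: (hilbert_dim_le (T := adjoint V)); [exact: perp_closed..|].
move=> y /perpP yB y0; apply: contrapT => nz.
have : V0 (adjoint V y).
  rewrite -(perp_perp cV0); apply/perpP => z pz; apply: contrapT => yz.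
  by apply: nz; exists z.
rewrite -AW0 => -[w0 Ww0 Aw0].
pose w := adjoint U w0.
have Ww : W w by rewrite /W /w/= unitary_adjointVK.
have yE : y = V (A (U w)) by rewrite /w unitary_adjointVK// Aw0 unitary_adjointVK.
have o : inner (B w) y = 0 by apply: inner_sym0; apply: yB; exists w.
have h1 : nrm y ^+ 2 <= nrm (B w - y) * nrm y.
  have := cauchy_schwarz (B w - y) y.
  by rewrite innerBl o sub0r cabsN inner_nrm cabs_real ?sqr_ge0.
have h2 := h w; rewrite -yE in h2.
have h3 := nA w Ww; rewrite -yE in h3.
have n0 := nrm_gt0 y0.
have : nrm y <= nrm (B w - y) by rewrite -(ler_pM2r n0) -expr2.
lra.
Qed.

Lemma closed_orbit2_sym (A B : bounded_op H K) : closed_orbit2 A B -> closed_orbit2 B A.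
Proof.
move=> /closed_orbit2P h; apply/closed_orbit2P => e /h[V [U [uV uU d]]].
exists (adjoint V), (adjoint U); split; [exact: unitary_adjoint..|move=> x].
have := d (adjoint U x); rewrite unitary_adjointVK//.
rewrite -(unitary_nrm _ (unitary_adjoint uV)) opB unitary_adjointK// nrm_subC.
by rewrite (unitary_nrm _ (unitary_adjoint uU)).
Qed.

Lemma iota_f_orbit_le (A B : bounded_op H K) : closed_orbit2 A B -> iota_f B #<= iota_f A.
Proof.
move=> /closed_orbit2P h.
have [c /h[V [U [uV uU d]]] hc] := iota_f_semicontinuous A.
exact: hc uV uU d.
Qed.

Lemma iota_f_orbit (A B : bounded_op H K) : closed_orbit2 A B -> iota_f B #= iota_f A.
Proof.
move=> h; apply/card_eqPle; split; first exact: iota_f_orbit_le.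
exact/iota_f_orbit_le/closed_orbit2_sym.
Qed.

(** If [C] is smaller on the complement of [W] than it is on [W1], then the
    codimension of [C W] is at most that of [V1]. Indeed no nonzero [y] in [V1] is
    orthogonal to [C W]: let [y = C w] with [w] in [W1], and let [w'] be the
    projection of [w] to [W]. Being orthogonal to [C w'], the vector [y] would have
    norm at most [|C (w - w')| <= d |w|], whereas [|y| >= c1 |w|]. *)
Lemma optimal_codim (C : bounded_op H K) (W W1 : set H) (V1 : set K) (c c1 d : R) :
  closed_subspace W -> 0 < c -> (forall w, W w -> c * nrm w <= nrm (C w)) ->
  (forall x, perp W x -> nrm (C x) <= d * nrm x) -> 0 <= d -> d < c1 ->
  closed_subspace V1 -> iota_f C #= hilbert_dim (perp V1) ->
  (forall w, W1 w -> c1 * nrm w <= nrm (C w)) -> V1 `<=` C @` W1 ->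
  hilbert_dim (perp (C @` W)) #= iota_f C.
Proof.
move=> cW c0 hW hWp d0 dc1 cV1 e1 hW1 V1W1.
have cCW := bounded_below_closed_image cW c0 hW.
apply/card_eqPle; split; last first.
  by apply: iota_f_le => // _ [w _ <-]; exists w.
rewrite (card_le_eqr e1).
apply: (hilbert_dim_le (T := id_op K)); [exact: perp_closed..|].
move=> y /perpP yC y0; apply: contrapT => nz.
have : V1 y.
  rewrite -(perp_perp cV1); apply/perpP => z pz; apply: contrapT => yz.
  by apply: nz; exists z.
move=> /V1W1[w Ww yE].
pose w' := proj W w.
have Ww' : W w' by exact: proj_in.
have pw : perp W (w - w') by exact: proj_perp.
have h1 := hWp _ pw.
have o : inner y (C w') = 0 by apply: yC; exists w'.
have h2 : nrm y ^+ 2 <= nrm y * nrm (C (w - w')).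
  have := cauchy_schwarz y (C (w - w')).
  by rewrite opB innerBr o subr0 yE inner_nrm cabs_real ?sqr_ge0.
have n0 := nrm_gt0 y0.
have h3 : nrm y <= nrm (C (w - w')) by rewrite -(ler_pM2l n0) -expr2.
have h4 := hW1 _ Ww; rewrite yE in h4.
have h5 : nrm (w - w') <= nrm w.
  have o' : inner (w - w') w' = 0 by move/perpP : pw; apply.
  have := pythagoras o'; rewrite subrK => h5.
  by rewrite -(@ler_pXn2r _ 2)// ?nnegrE ?nrm_ge0// h5 ?lerDl ?sqr_ge0.
have [nw|] := eqVneq w 0.
  by move: y0; rewrite -yE nw op0 eqxx.
move=> /nrm_gt0 nw.
have : d * nrm (w - w') <= d * nrm w by rewrite ler_wpM2l.
have : d * nrm w < c1 * nrm w by rewrite ltr_pM2r.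
lra.
Qed.

(** The map [A w |-> B w] is nearly isometric from [A W] onto [B W]. It extends to a
    nearly isometric bijection [D] of [K] by any isometry between the orthogonal
    complements, which is where the equality of the dimensions is needed; a unitary
    close to [D] does the job. *)
Lemma unitary_match (B A : bounded_op H K) (W : set H) (a d : R) : closed_subspace W ->
  0 < a -> 0 <= d -> d / a ^+ 2 <= 1 / 2 ->
  (forall w, W w -> a * nrm w <= nrm (B w)) ->
  (forall w, W w -> a * nrm w <= nrm (A w)) ->
  (forall x y, cabs (inner (B x) (B y) - inner (A x) (A y)) <= d * nrm x * nrm y) ->
  hilbert_dim (perp (A @` W)) #= hilbert_dim (perp (B @` W)) ->
  exists2 V : bounded_op K K, unitary V &
    forall w, W w -> nrm (V (A w) - B w) <= 4 * (d / a ^+ 2) * nrm (A w).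
Proof.
move=> cW a0 d0 da hB hA hAB hdim; have lW := cW.1.
have cA := bounded_below_closed_image cW a0 hA.
have cB := bounded_below_closed_image cW a0 hB.
have [u [uXY uiso usurj u0]] :=
  exists_partial_isometry (perp_closed _) (perp_closed _) hdim.
have Ainj w w' : W w -> W w' -> A w = A w' -> w = w'.
  move=> Ww Ww' e; apply/eqP; rewrite -subr_eq0; apply/eqP/nrm_eq0/eqP.
  have := hA _ (lsubB lW Ww Ww'); rewrite opB e subrr nrm0 pmulr_rle0// => h.
  by rewrite eq_le h nrm_ge0.
have /choice[r rP] (k : K) : exists w, W w /\ A w = proj (A @` W) k.
  by have [w Ww e] := proj_in k cA; exists w.
have rlin : linear r.
  move=> b x y; apply: Ainj; [exact: (rP _).1|by apply: lsubZD => //; exact: (rP _).1|].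
  by rewrite opP !(rP _).2 proj_linear.
have rn k : nrm (r k) <= a^-1 * nrm k.
  rewrite ler_pdivlMl// (le_trans (hA _ (rP k).1))// (rP k).2.
  exact: nrm_proj_le.
have [r' r'E] := exists_op rlin rn.
pose D : bounded_op K K := comp_op B r' + u.
(* u is an isometry of the complement of A W onto that of B W, zero on A W. *)
have uproj k : u k = u (k - proj (A @` W) k).
  rewrite opB [u (proj _ _)]u0 ?subr0// perp_perp//.
  exact: proj_in.
have DE k : D k = B (r k) + u (k - proj (A @` W) k).
  by rewrite -uproj -r'E.
have rA w x : W w -> perp (A @` W) x -> r (A w + x) = w.
  move=> Ww px; apply: Ainj => //; first exact: (rP _).1.
  rewrite (rP _).2; apply: proj_uniq => //.
  by rewrite addrAC subrr add0r.
have DA w x : W w -> perp (A @` W) x -> D (A w + x) = B w + u x.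
  move=> Ww px; rewrite DE -(rP _).2 rA//.
  by rewrite addrAC subrr add0r.
have [|//|y|y z|V [uV hV]] := @exists_near_unitary _ K D (d / a ^+ 2).
- by rewrite divr_ge0// sqr_ge0.
- have [w Ww Bw] := proj_in y cB.
  have [x px ux] := usurj _ (proj_perp y cB).
  by exists (A w + x); rewrite DA// Bw ux addrC subrK.
- have dec k : exists w x, [/\ W w, perp (A @` W) x, k = A w + x & nrm w <= a^-1 * nrm k].
    exists (r k), (k - proj (A @` W) k); split=> //; first exact: (rP k).1.
      exact: proj_perp.
    by rewrite (rP k).2 addrC subrK.
  have [w [x [Ww px yE nw]]] := dec y; have [w' [x' [Ww' px' zE nw']]] := dec z.
  have -> : inner (D y) (D z) - inner y z = inner (B w) (B w') - inner (A w) (A w').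
    rewrite yE zE !DA// !innerDl !innerDr uiso//.
    have c1 : inner (B w) (u x') = 0.
      by apply: inner_sym0; move/perpP : (uXY _ px'); apply; exists w.
    have c2 : inner (u x) (B w') = 0.
      by move/perpP : (uXY _ px); apply; exists w'.
    have c3 : inner (A w) x' = 0.
      by apply: inner_sym0; move/perpP : px'; apply; exists w.
    have c4 : inner x (A w') = 0.
      by move/perpP : px; apply; exists w'.
    by rewrite c1 c2 c3 c4 !addr0 !add0r opprD addrACA subrr addr0.
  rewrite (le_trans (hAB w w'))//.
  have -> : d / a ^+ 2 * nrm y * nrm z = d * (a^-1 * nrm y) * (a^-1 * nrm z).
    by field; rewrite gt_eqF.
  apply: ler_pM => //; [by rewrite mulr_ge0 ?nrm_ge0|exact: nrm_ge0|].
  by rewrite ler_wpM2l.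
exists V => // w Ww.
have p0 : perp (A @` W) 0 by apply: lsub0; exact: perp_linear.
have := hV (A w); have := DA w 0 Ww p0.
by rewrite addr0 op0 addr0 => ->.
Qed.

Lemma nrm_sub_le_split (B C : bounded_op H K) (W : set H) (q b c : R) x :
  closed_subspace W -> 0 <= q -> 0 <= b + c ->
  (forall w, W w -> nrm (B w - C w) <= q * nrm w) ->
  (forall z, perp W z -> nrm (B z) <= b * nrm z) ->
  (forall z, perp W z -> nrm (C z) <= c * nrm z) ->
  nrm (B x - C x) <= (q + (b + c)) * nrm x.
Proof.
move=> cW q0 bc0 hW hB hC; pose w := proj W x.
have Ww : W w by exact: proj_in.
have px : perp W (x - w) by exact: proj_perp.
have o : inner (x - w) w = 0 by move/perpP : px; apply.
have := pythagoras o; rewrite subrK => pyth.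
have nw : nrm w <= nrm x.
  by rewrite -(@ler_pXn2r _ 2)// ?nnegrE ?nrm_ge0// pyth lerDr sqr_ge0.
have nxw : nrm (x - w) <= nrm x.
  by rewrite -(@ler_pXn2r _ 2)// ?nnegrE ?nrm_ge0// pyth lerDl sqr_ge0.
have -> : B x - C x = (B w - C w) + (B (x - w) - C (x - w)).
  by rewrite addrACA -opprD -!opD [w + _]addrC subrK.
have h1 := nrmD (B w - C w) (B (x - w) - C (x - w)).
have h2 := nrmB (B (x - w)) (C (x - w)).
have h3 := hW w Ww; have h4 := hB _ px; have h5 := hC _ px.
have h6 := ler_wpM2l q0 nw; have h7 := ler_wpM2l bc0 nxw.
lra.
Qed.

(** Cut the space by [B^* B] into a subspace [W] on which [B] is bounded below by
    [a] and its complement, where [B] is at most [a]. Let [A1 = A U] be such that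
    [A1^* A1] is within [d] of [B^* B]: the same bounds hold for [A1] up to
    factors 2. For [a] small, [optimal_codim] shows that the complements of [B W]
    and [A1 W] have the dimensions [iota_f B] and [iota_f A], which are equal. So
    [unitary_match] provides a unitary [V] for which [V A1] is close to [B] on [W];
    on the complement of [W] both operators are small. *)
Lemma orbit_of_gram (A B : bounded_op H K) :
  closed_unitary_orbit (comp_op (adjoint A) A) (comp_op (adjoint B) B) ->
  iota_f B #= iota_f A -> closed_orbit2 A B.
Proof.
move=> /closed_unitary_orbitP hgram hiota; apply/closed_orbit2P => e e0.
have [V0 [cV0 V0A e0A]] := iota_f_attained A.
have [W0 [c0 [cW0 c0p hW0 _ AW0]]] := closed_image_section cV0 V0A.
have [V1 [cV1 V1B e1B]] := iota_f_attained B.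
have [W1 [c1 [cW1 c1p hW1 _ BW1]]] := closed_image_section cV1 V1B.
(* On the complement of W the error is at most a + 2 a <= e / 2; moreover 2 a
   must stay below the lower bounds c0 and c1 of A and B on the sections. *)
pose a := Num.min (e / 8) (Num.min (c0 / 4) (c1 / 4)).
have a0 : 0 < a by rewrite !lt_min !divr_gt0.
have ae : a <= e / 8 by rewrite ge_min lexx.
have ac0 : a <= c0 / 4 by rewrite !ge_min lexx orbT.
have ac1 : a <= c1 / 4 by rewrite !ge_min lexx !orbT.
have sT : symmetric_op (comp_op (adjoint B) B).
  by move=> x y; rewrite !comp_opE -adjointPr adjointP.
have [W [cW hW hWp]] := spectral_cut (a ^+ 2) sT.
have gramE x : re_inner (comp_op (adjoint B) B x) x = nrm (B x) ^+ 2.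
  by rewrite comp_opE /re_inner -adjointPr -/(re_inner _ _) re_innerxx.
have hBW w : W w -> a * nrm w <= nrm (B w).
  move=> /hW; rewrite gramE -exprMn.
  by rewrite ler_pXn2r ?nnegrE ?mulr_ge0 ?nrm_ge0// ltW.
have hBWp x : perp W x -> nrm (B x) <= a * nrm x.
  move=> /hWp; rewrite gramE -exprMn.
  by rewrite ler_pXn2r ?nnegrE ?mulr_ge0 ?nrm_ge0// ltW.
pose M := op_nrm B + 1.
have M0 : 0 < M by rewrite /M; have := op_nrm_ge0 B; lra.
(* d is negligible with respect to a ^ 2, and the last term makes the error
   16 d / a ^ 2 * |A1 w| of the matching unitary on W at most e / 2 * |w|. *)
pose d := Num.min 1 (Num.min (a ^+ 2 / 8) (e * a ^+ 2 / (32 * M))).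
have a2 : 0 < a ^+ 2 by rewrite exprn_gt0.
have d0 : 0 < d by rewrite !lt_min ltr01 !divr_gt0 ?mulr_gt0.
have d1 : d <= 1 by rewrite ge_min lexx.
have da : d <= a ^+ 2 / 8 by rewrite !ge_min lexx orbT.
have de : d <= e * a ^+ 2 / (32 * M) by rewrite !ge_min lexx !orbT.
have [U uU hU] := hgram d d0.
pose A1 := comp_op A U.
have A1E x : A1 x = A (U x) by [].
have hAB x y : cabs (inner (B x) (B y) - inner (A1 x) (A1 y)) <= d * nrm x * nrm y.
  have -> : inner (B x) (B y) - inner (A1 x) (A1 y) =
      inner (comp_op (adjoint B) B x - adjoint U (comp_op (adjoint A) A (U x))) y.
    by rewrite innerBl !comp_opE -!adjointPr.
  rewrite (le_trans (cauchy_schwarz _ _))//.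
  by rewrite ler_wpM2r ?nrm_ge0.
have hAB2 x : `|nrm (B x) ^+ 2 - nrm (A1 x) ^+ 2| <= d * nrm x ^+ 2.
  have := hAB x x; rewrite !inner_nrm -rmorphB/= -mulrA -expr2.
  by apply: le_trans; exact: (cabs_ge_Re (nrm (B x) ^+ 2 - nrm (A1 x) ^+ 2)%:C).
have hAW w : W w -> a / 2 * nrm w <= nrm (A1 w).
  move=> Ww; rewrite -(@ler_pXn2r _ 2)// ?nnegrE ?mulr_ge0 ?nrm_ge0//; last by lra.
  have := hAB2 w; rewrite ler_norml => /andP[_].
  have : (a * nrm w) ^+ 2 <= nrm (B w) ^+ 2.
    by rewrite ler_pXn2r ?nnegrE ?mulr_ge0 ?nrm_ge0 ?(ltW a0)//; exact: hBW.
  rewrite !exprMn; have := sqr_ge0 (nrm w); nra.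
have hAWp x : perp W x -> nrm (A1 x) <= 2 * a * nrm x.
  move=> px; rewrite -(@ler_pXn2r _ 2)// ?nnegrE ?mulr_ge0 ?nrm_ge0//; last by lra.
  have := hAB2 x; rewrite ler_norml => /andP[+ _].
  have : nrm (B x) ^+ 2 <= (a * nrm x) ^+ 2.
    by rewrite ler_pXn2r ?nnegrE ?mulr_ge0 ?nrm_ge0 ?(ltW a0)//; exact: hBWp.
  rewrite !exprMn; have := sqr_ge0 (nrm x); nra.
have rA1 : range A1 = range A.
  apply/seteqP; split=> [_ [x _ <-]|_ [x _ <-]]; first by exists (U x).
  by exists (adjoint U x) => //; rewrite A1E unitary_adjointVK.
have iA1 : iota_f A1 = iota_f A by rewrite /iota_f rA1.
have dimB : hilbert_dim (perp (B @` W)) #= iota_f B.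
  apply: (optimal_codim (c := a) (c1 := c1) (d := a) (W1 := W1) (V1 := V1)) => //; [lra|lra|].
  by rewrite BW1.
have dimA : hilbert_dim (perp (A1 @` W)) #= iota_f A.
  rewrite -iA1.
  apply: (optimal_codim (c := a / 2) (c1 := c0) (d := 2 * a)
    (W1 := [set x | W0 (U x)]) (V1 := V0)) => //; [lra|lra|lra|by rewrite iA1| |].
    by move=> w /hW0; rewrite unitary_nrm.
  rewrite -AW0 => _ [w Ww <-]; exists (adjoint U w); first by rewrite /= unitary_adjointVK.
  by rewrite A1E unitary_adjointVK.
have dimAB : hilbert_dim (perp (A1 @` W)) #= hilbert_dim (perp (B @` W)).
  by rewrite (card_eql dimA) (card_eqr dimB) card_eq_sym.
have a20 : 0 < a / 2 by rewrite divr_gt0.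
have da2 : d / (a / 2) ^+ 2 <= 1 / 2.
  by rewrite ler_pdivrMr ?exprn_gt0//; move: da; rewrite expr_div_n; lra.
have hBW2 w : W w -> a / 2 * nrm w <= nrm (B w).
  by move=> /hBW; have := mulr_ge0 (ltW a0) (nrm_ge0 w); lra.
have [V uV hV] := unitary_match cW a20 (ltW d0) da2 hBW2 hAW hAB dimAB.
exists V, U; split=> // x; rewrite -A1E.
have h8 : 4 * (d / (a / 2) ^+ 2) * M <= e / 2.
  rewrite expr_div_n.
  have -> : 4 * (d / (a ^+ 2 / 2 ^+ 2)) * M = (d * (32 * M)) / (2 * a ^+ 2).
    by field; rewrite gt_eqF.
  rewrite ler_pdivrMr ?mulr_gt0//.
  move: de; rewrite ler_pdivlMr ?mulr_gt0//; lra.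
have q0 : 0 <= 4 * (d / (a / 2) ^+ 2).
  by rewrite mulr_ge0// divr_ge0 ?sqr_ge0// ltW.
move: h8 q0 hV; set q := 4 * (d / _) => h8 q0 hV.
have close w : W w -> nrm (B w - comp_op V A1 w) <= e / 2 * nrm w.
  move=> Ww; have h4 : nrm (A1 w) <= M * nrm w.
    rewrite -(@ler_pXn2r _ 2)// ?nnegrE ?mulr_ge0 ?nrm_ge0//; last by lra.
    have := hAB2 w; rewrite ler_norml => /andP[+ _].
    have : nrm (B w) ^+ 2 <= (op_nrm B * nrm w) ^+ 2.
      by rewrite ler_pXn2r ?nnegrE ?mulr_ge0 ?nrm_ge0 ?op_nrm_ge0//; exact: nrm_op.
    rewrite !exprMn /M; have := sqr_ge0 (nrm w); have := op_nrm_ge0 B; nra.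
  have r1 := ler_wpM2l q0 h4; have r2 := ler_wpM2r (nrm_ge0 w) h8.
  by have := hV w Ww; rewrite nrm_subC comp_opE; lra.
have abc : 0 <= a + 2 * a by lra.
have e20 : 0 <= e / 2 by lra.
have h := nrm_sub_le_split x cW e20 abc close hBWp.
apply: le_trans (h _) _ => [z pz|].
  by rewrite comp_opE unitary_nrm//; exact: hAWp.
by rewrite ler_wpM2r ?nrm_ge0//; lra.
Qed.

End orbits.

(** * Passing to the adjoint *)

Section adjoint_orbit.
Variables (R : realType) (H K : hilbertType R).

(** If [V] is a closed subspace of the range of [A], then [A^*] is bounded below on
    [V], so [A^* V] is a closed subspace of the range of [A^*]. The vectors [x]
    orthogonal to [A^* V] are those with [A x] orthogonal to [V], and [A] is
    injective on the closure of the range of [A^*]. *)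
Lemma IC_adjoint_le (A : bounded_op H K) : IC (range (adjoint A)) #<= IC (range A).
Proof.
have [V [cV VA ->]] := IC_attained (range_linear A).
have [W [c [cW c0 hW WA AW]]] := closed_image_section cV VA.
have hV v : V v -> c * nrm v <= nrm (adjoint A v).
  rewrite -AW => -[w Ww <-].
  have [->|w0] := eqVneq w 0; first by rewrite !op0 !nrm0 mulr0.
  have n0 := nrm_gt0 w0.
  have := cauchy_schwarz (adjoint A (A w)) w.
  rewrite -adjointPr inner_nrm cabs_real ?sqr_ge0// => h1.
  have h2 := hW w Ww.
  rewrite -(ler_pM2r n0) (le_trans _ h1)// expr2 mulrAC.
  by rewrite ler_wpM2r ?nrm_ge0.
have cV' := bounded_below_closed_image cV c0 hV.
have V'A : adjoint A @` V `<=` range (adjoint A) by move=> _ [v _ <-]; exists v.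
apply: card_le_trans (IC_le (range_linear _) cV' V'A) _.
have cE := closure_closed_subspace (range_linear A).
have cE' := closure_closed_subspace (range_linear (adjoint A)).
apply: (hilbert_dim_le (T := A)); [exact: ominus_closed..|].
move=> x [Ex xV] x0; exists (A x).
  split; first by apply: subset_closure; exists x.
  by move=> v Vv; rewrite adjointP; apply: xV; exists v.
move=> /inner_self0 Ax; move/eqP : x0; apply.
apply: (perp_self0 Ex); rewrite perp_closure perp_range_adjoint.
exact: Ax.
Qed.

End adjoint_orbit.

(** The kernel of [A] is the orthogonal complement of the range of [A^*]. *)
Lemma iota_i_adjoint (R : realType) (H K : hilbertType R) (A : bounded_op H K) :
  iota_i A #= iota_f (adjoint A).
Proof.
rewrite /iota_i /iota_f -perp_range_adjoint -perp_closure.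
apply: card_sum_eq; first exact: card_eqxx.
apply/card_eqPle; split; last exact: IC_adjoint_le.
by have := IC_adjoint_le (adjoint A); rewrite adjointK.
Qed.

Lemma closed_orbit2_adjoint (R : realType) (H K : hilbertType R) (A B : bounded_op H K) :
  closed_orbit2 A B -> closed_orbit2 (adjoint A) (adjoint B).
Proof.
move=> /closed_orbit2P h; apply/closed_orbit2P => e e0.
have [V [U [uV uU d]]] := h e e0.
exists (adjoint U), (adjoint V); split; [exact: unitary_adjoint..|move=> y].
apply: nrm_le_inner; first by rewrite mulr_ge0 ?nrm_ge0// ltW.
move=> x.
have -> : inner (adjoint B y - adjoint U (adjoint A (adjoint V y))) x =
    inner y (B x - V (A (U x))).
  by rewrite innerBl innerBr -!adjointPr.
rewrite (le_trans (cauchy_schwarz _ _))//.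
by rewrite (mulrC e) -mulrA ler_wpM2l ?nrm_ge0.
Qed.

Theorem closed_orbit2E (R : realType) (H K : hilbertType R) (A B : bounded_op H K) :
  closed_orbit2 A B <->
  closed_unitary_orbit (comp_op (adjoint A) A) (comp_op (adjoint B) B) /\
  iota_f B #= iota_f A.
Proof.
split=> [h|[]]; last exact: orbit_of_gram.
by split; [exact: gram_orbit|exact: iota_f_orbit].
Qed.

Theorem proposition3p14 (R : realType) (H K : hilbertType R)
    (A : bounded_op H K) :
  (iota_i A #<= iota_f A ->
     closed_orbit2 A =
     [set B | closed_unitary_orbit (comp_op (adjoint A) A)
                (comp_op (adjoint B) B)
              /\ iota_f B #= iota_f A])
  /\
  (iota_f A #<= iota_i A ->
     closed_orbit2 A =
     [set B | closed_unitary_orbit (comp_op A (adjoint A))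
                (comp_op B (adjoint B))
              /\ iota_i B #= iota_i A]).
Proof.
split=> _; apply/seteqP; split=> B /=.
- by move/closed_orbit2E.
- by move=> h; apply/closed_orbit2E.
- move=> /closed_orbit2_adjoint/closed_orbit2E; rewrite !adjointK => -[hB e]; split=> //.
  by rewrite (card_eql (iota_i_adjoint B)) (card_eqr (iota_i_adjoint A)).
- move=> [hB e]; rewrite -(adjointK A) -(adjointK B).
  apply/closed_orbit2_adjoint/closed_orbit2E; rewrite !adjointK; split=> //.
  by rewrite -(card_eql (iota_i_adjoint B)) -(card_eqr (iota_i_adjoint A)).
Qed.
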